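(* In the braided symmetric algebra $\mathcal{A}_m$, assume that $i<j<r<s<t$ (indices in $\{1,\dots,m\}$). Then $$q\Psi^{(j,s,t)}\Phi^{(i,r)}=q^{-1}\Phi^{(i,r)}\Psi^{(j,s,t)}-(q-q^{-1})\Phi^{(i,j)}\Psi^{(r,s,t)}-(q-q^{-1})\left(-(q^2+q^{-2})\Phi^{(j,r)}\Psi^{(i,s,t)}+\Theta^{(i,j,r,s,t)}\right).$$
   Context: $\mathrm{U}_q=\mathrm{U}_q(G_2)$ is the quantum group over $\mathbb{C}(q)$ ($q$ an indeterminate) with generators $E_i,F_i,K_i^{\pm1}$, $i=1,2$, and the standard Drinfeld–Jimbo relations, for simple roots $\alpha_1$ (short), $\alpha_2$ with $(\alpha_1,\alpha_1)=2$, $(\alpha_1,\alpha_2)=-3$, $(\alpha_2,\alpha_2)=6$. Co-multiplication: $\Delta(E_i)=E_i\otimes K_i+1\otimes E_i$, $\Delta(F_i)=F_i\otimes 1+K_i^{-1}\otimes F_i$, $\Delta(K_i)=K_i\otimes K_i$. $V_\lambda$ is the type-$\mathbf 1$ simple module with highest weight $\lambda$; $\lambda_1=2\alpha_1+\alpha_2$, $\lambda_2=3\alpha_1+2\alpha_2$. $V=V_{\lambda_1}$ is the 7-dimensional simple module with basis $v_1,v_2,v_3,v_0,v_{-3},v_{-2},v_{-1}$ and action (basis vectors not listed are sent to $0$): $E_1: v_2\mapsto v_1,\ v_0\mapsto (q+q^{-1})v_3,\ v_{-3}\mapsto -(q+q^{-1})v_0,\ v_{-1}\mapsto -v_{-2}$;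 $E_2: v_3\mapsto v_2,\ v_{-2}\mapsto -v_{-3}$; $F_1: v_1\mapsto v_2,\ v_3\mapsto v_0,\ v_0\mapsto -v_{-3},\ v_{-2}\mapsto -v_{-1}$; $F_2: v_2\mapsto v_3,\ v_{-3}\mapsto -v_{-2}$; $K_1$, $K_2$ act diagonally (in the order $v_1,v_2,v_3,v_0,v_{-3},v_{-2},v_{-1}$) with eigenvalues $(q,q^{-1},q^2,1,q^{-2},q,q^{-1})$ and $(1,q^3,q^{-3},1,q^3,q^{-3},1)$. $V\otimes V=V_{2\lambda_1}\oplus V_{\lambda_2}\oplus V_{\lambda_1}\oplus V_0$; $\wedge_q^2V=V_{\lambda_2}\oplus V_{\lambda_1}$; $S_q(V)=T(V)/\langle\wedge_q^2V\rangle$; $X_a$ is the image of $v_a$. Braiding: with universal $R$-matrix $\sum_t\alpha_t\otimes\beta_t$, set $\check R_{W,W'}(w\otimes w')=\sum_t\beta_tw'\otimes\alpha_tw$, normalised so that $\check R_{V,V}=q^2P[2\lambda_1]+q^{-12}P[0]-P[\lambda_2]-q^{-6}P[\lambda_1]$, with $P[\mu]$ the projection of $V\otimes V$ onto $V_\mu$. The braided tensor product of module algebras $A,B$ is $A\otimes B$ with multiplication $(\mu_A\otimes\mu_B)(\mathrm{id}_A\otimes\check R_{B,A}\otimes\mathrm{id}_B)$; $\mathcal{A}_m$ is $S_q(V)^{\otimes m}$ with the iterated braided multiplication. Put $X_{ia}=1^{\otimes(i-1)}\otimes X_a\otimes1^{\otimes(m-i)}$; thus $X_{ja}X_{ib}=\sum_t\beta_t(X_{ib})\alpha_t(X_{ja})$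 for $i<j$. Let $\varphi_{1,-1}=q^4$, $\varphi_{-1,1}=q^{-6}$, $\varphi_{2,-2}=q^3$, $\varphi_{-2,2}=q^{-5}$, $\varphi_{3,-3}=1$, $\varphi_{-3,3}=q^{-2}$, $\varphi_{00}=1$, other $\varphi_{ab}=0$. Let $\gamma:V\to V\otimes V$ be the unique $\mathrm{U}_q$-map with $\gamma(v_1)=v_1\otimes v_0-q^{-6}v_0\otimes v_1-(q^{-3}+q^{-1})(v_2\otimes v_3-q^{-3}v_3\otimes v_2)$, and write $\gamma(v_a)=\sum_{r,s}\gamma_{ars}v_r\otimes v_s$. Put $c_{rst}=-q^3\sum_c\varphi_{rc}\gamma_{cst}$ and $\Psi=\sum c_{rst}v_r\otimes v_s\otimes v_t\in(V^{\otimes3})^{\mathrm{U}_q}$. Define $\Phi^{(i,j)}=\sum_{a,b}\varphi_{ab}X_{ia}X_{jb}$ and $\Psi^{(i,j,k)}=\sum_{r,s,t}c_{rst}X_{ir}X_{js}X_{kt}$. The invariant $\Theta\in(V^{\otimes5})^{\mathrm{U}_q}$ is given by the planar trivalent tree with 5 top end points in which a central vertex is joined to end point 1, to a vertex carrying end points 2 and 3, and to a vertex carrying end points 4 and 5; explicitly (each splitting vertex $V\to V\otimes V$ being $-q^3\gamma$ and the tripod being $\Psi$), $\Theta=q^6(\mathrm{id}_V\otimes\gamma\otimes\gamma)(\Psi)$. For $i<j<r<s<t$, $\Theta^{(i,j,r,s,t)}\in\mathcal{A}_m$ is the element obtained from $\Theta=\sum\theta_{abcde}v_a\otimes v_b\otimes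 v_c\otimes v_d\otimes v_e$ as $\sum\theta_{abcde}X_{ia}X_{jb}X_{rc}X_{sd}X_{te}$. *)

(* Defs.v *)
From HB Require Import structures.
From mathcomp Require Import all_boot all_order all_algebra.
From mathcomp Require Import finmap reals complex.
From mathcomp.multinomials Require Import monalg.

Set Implicit Arguments.
Unset Strict Implicit.
Unset Printing Implicit Defensive.

Import GRing.Theory Num.Theory.
Local Open Scope ring_scope.

(* The field C(q), with C = R[i] for a model R of the real numbers. *)
Definition Cq (R : realType) := {fraction {poly R[i]}}.
Definition indet (R : realType) : Cq R := tofrac ('X : {poly R[i]}).

(* Generators of U_q(G_2), indexed by the simple roots
   alpha_1 (index 0, short) and alpha_2 (index 1). *)
Inductive Uq_gen : Type :=
  | gE of 'I_2 | gF of 'I_2 | gK of 'I_2 | gKinv of 'I_2.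

Definition Uq_gens : seq Uq_gen :=
  [seq gE i | i <- enum 'I_2] ++ [seq gF i | i <- enum 'I_2] ++
  [seq gK i | i <- enum 'I_2] ++ [seq gKinv i | i <- enum 'I_2].

(* (a, b) stands for a alpha_1 + b alpha_2; for G_2 the weight lattice is the
   root lattice. *)
Definition weight := (int * int)%type.
Definition lambda1 : weight := (2, 1).
Definition lambda2 : weight := (3, 2).

(* (mu, alpha_i), from (alpha_1, alpha_1) = 2, (alpha_1, alpha_2) = -3,
   (alpha_2, alpha_2) = 6. *)
Definition pairing (mu : weight) (i : 'I_2) : int :=
  if i == 0 then mu.1 * 2 + mu.2 * (- 3) else mu.1 * (- 3) + mu.2 * 6.

(* Indices of the basis v_1, v_2, v_3, v_0, v_{-3}, v_{-2}, v_{-1} of V. *)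
Definition p1 : 'I_7 := @Ordinal 7 0 isT.
Definition p2 : 'I_7 := @Ordinal 7 1 isT.
Definition p3 : 'I_7 := @Ordinal 7 2 isT.
Definition z0 : 'I_7 := @Ordinal 7 3 isT.
Definition n3 : 'I_7 := @Ordinal 7 4 isT.
Definition n2 : 'I_7 := @Ordinal 7 5 isT.
Definition n1 : 'I_7 := @Ordinal 7 6 isT.

Section G2.

Context {K : fieldType} (q : K).

(* V is 'cV[K]_7, on which matrices act on the left. *)
Definition vb (a : 'I_7) : 'cV[K]_7 := delta_mx a 0.

(* The matrix of v_a |-> v_b (and v_c |-> 0 for c != a). *)
Definition arrow (a b : 'I_7) : 'M[K]_7 := delta_mx b a.

Definition actE (i : 'I_2) : 'M[K]_7 :=
  if i == 0 then
    arrow p2 p1 + (q + q^-1) *: arrow z0 p3 - (q + q^-1) *: arrow n3 z0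
    - arrow n1 n2
  else arrow p3 p2 - arrow n2 n3.

Definition actF (i : 'I_2) : 'M[K]_7 :=
  if i == 0 then
    arrow p1 p2 + arrow p3 z0 - arrow z0 n3 - arrow n2 n1
  else arrow p2 p3 - arrow n3 n2.

Definition K_exponents (i : 'I_2) : seq int :=
  if i == 0 then [:: 1; -1; 2; 0; -2; 1; -1]
  else [:: 0; 3; -3; 0; 3; -3; 0].

Definition actK (i : 'I_2) : 'M[K]_7 :=
  diag_mx (\row_a q ^ (K_exponents i)`_a).

Definition actV (g : Uq_gen) : 'M[K]_7 :=
  match g with
  | gE i => actE i
  | gF i => actF i
  | gK i => actK i
  | gKinv i => invmx (actK i)
  end.

(* V (x) V is 'M[K]_7: the matrix M stands for \sum_(r, s) M r s v_r (x) v_s,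
   so that v_r (x) v_s is delta_mx r s and A (x) B is M |-> A M B^T. *)
Definition tens (A B : 'M[K]_7) : 'End('M[K]_7) :=
  linfun (mulmxr B^T \o mulmx A).

Definition actVV (g : Uq_gen) : 'End('M[K]_7) :=
  match g with
  | gE i => tens (actE i) (actK i) + tens 1%:M (actE i)
  | gF i => tens (actF i) 1%:M + tens (invmx (actK i)) (actF i)
  | gK i => tens (actK i) (actK i)
  | gKinv i => tens (invmx (actK i)) (invmx (actK i))
  end.

Definition highest_weight_space (mu : weight) : {vspace 'M[K]_7} :=
  (\bigcap_(i < 2) (lker (actVV (gE i)) :&:
      lker (actVV (gK i) - (q ^ pairing mu i) *: \1%VF)))%VS.

(* The submodule generated by W: the iteration is an increasing sequence of
   subspaces, which is stationary after at most \dim (V (x) V) steps. *)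
Definition submodule_generated (W : {vspace 'M[K]_7}) : {vspace 'M[K]_7} :=
  iter (\dim {:'M[K]_7})
    (fun U => (U + \sum_(g <- Uq_gens) actVV g @: U)%VS) W.

(* The V_mu-isotypic part of V (x) V, which is the simple summand V_mu for
   the four weights below since they occur with multiplicity one. *)
Definition Vcomp (mu : weight) : {vspace 'M[K]_7} :=
  submodule_generated (highest_weight_space mu).

Definition VV_weights : seq weight :=
  [:: lambda1 *+ 2; lambda2; lambda1; 0].

Definition proj (mu : weight) : 'End('M[K]_7) :=
  daddv_pi (Vcomp mu) (\sum_(nu <- VV_weights | nu != mu) Vcomp nu)%VS.

Definition wedge2 : {vspace 'M[K]_7} := (Vcomp lambda2 + Vcomp lambda1)%VS.

Definition RVV : 'End('M[K]_7) :=
  q ^+ 2 *: proj (lambda1 *+ 2) + q ^- 12 *: proj 0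
  - proj lambda2 - q ^- 6 *: proj lambda1.

(* {malg K[T]} is the K-vector space with basis T. *)
Definition linext (T T' : choiceType) (f : T -> {malg K[T']})
    (x : {malg K[T]}) : {malg K[T']} :=
  \sum_(k <- msupp x) x@_k *: f k.

(* The word [:: a1; ...; ak] stands for v_a1 (x) ... (x) v_ak, so that T(V) is
   {malg K[word]}, with product given by concatenation. *)
Definition word := seq 'I_7.

(* The braiding V (x) T(V) -> T(V) (x) V, extended from RVV by
   R_{V, V (x) W} = (id (x) R_{V, W}) (R_{V, V} (x) id). *)
Fixpoint braid_letter (a : 'I_7) (w : word) : {malg K[(word * 'I_7)%type]} :=
  if w is b :: w' then
    \sum_(b' < 7) \sum_(a' < 7) (RVV (delta_mx a b)) b' a' *:
      linext (fun p => << (b' :: p.1, p.2) >>) (braid_letter a' w')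
  else << ([::], a) >>.

(* The braiding T(V) (x) T(V) -> T(V) (x) T(V), by
   R_{V (x) U, W} = (R_{V, W} (x) id) (id (x) R_{U, W}). *)
Fixpoint braid_word (u w : word) : {malg K[(word * word)%type]} :=
  if u is a :: u' then
    linext (fun p => linext (fun p' => << (p'.1, p'.2 :: p.2) >>)
                       (braid_letter a p.1))
      (braid_word u' w)
  else << (w, [::]) >>.

(* T(V)^{(x) m} is the subspace of {malg K[seq word]} spanned by the sequences
   [:: u_1; ...; u_m] of m words, which stand for u_1 (x) ... (x) u_m. *)
Definition tpower := {malg K[seq word]}.

(* The braiding T(V)^{(x) n} (x) T(V) -> T(V) (x) T(V)^{(x) n}. *)
Fixpoint braid_words (us : seq word) (w : word) :
    {malg K[(word * seq word)%type]} :=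
  if us is u :: us' then
    linext (fun p => linext (fun p' => << (p'.1, p'.2 :: p.2) >>)
                       (braid_word u p.1))
      (braid_words us' w)
  else << (w, [::]) >>.

(* The multiplication of T(V) (x) T(V)^{(x) n}, that is
   (mu (x) mu_n) (id (x) R (x) id), for the iterated multiplication mu_n of
   T(V)^{(x) n}; only sequences of equal sizes are meaningful. *)
Fixpoint bmul_words (us ws : seq word) : tpower :=
  match us, ws with
  | u :: us', w :: ws' =>
      linext (fun p => linext (fun vs => << (u ++ p.1) :: vs >>)
                         (bmul_words p.2 ws'))
        (braid_words us' w)
  | _, _ => << [::] >>
  end.

Definition bmul (x y : tpower) : tpower :=
  linext (fun us => linext (bmul_words us) y) x.

(* us (x) (u r v) (x) ws, for words u, v and r in V (x) V. *)
Definition insert_rel (us ws : seq word) (u v : word) (r : 'M[K]_7) : tpower :=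
  \sum_(a < 7) \sum_(b < 7) r a b *:
    << us ++ (u ++ a :: b :: v) :: ws >>.

(* The kernel of T(V)^{(x) m} -> S_q(V)^{(x) m}: one of the tensor factors lies
   in the two-sided ideal of T(V) generated by wedge2. *)
Inductive Sq_ker (m : nat) : tpower -> Prop :=
  | Sq_ker0 : Sq_ker m 0
  | Sq_kerD us ws u v r x :
      (size us + size ws).+1 = m -> r \in wedge2 -> Sq_ker m x ->
      Sq_ker m (insert_rel us ws u v r + x).

(* Equality in A_m = S_q(V)^{(x) m} of the classes of x and y.  The kernel is
   an ideal for bmul, by naturality of the braiding with respect to the
   submodule wedge2, so that the product of A_m is induced by bmul. *)
Definition eqA (m : nat) (x y : tpower) : Prop := Sq_ker m (x - y).

Definition X (m : nat) (i : 'I_m) (a : 'I_7) : tpower :=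
  << mkseq (fun k => if k == i then [:: a] else [::]) m >>.

Definition phi : 'M[K]_7 :=
  q ^+ 4 *: delta_mx p1 n1 + q ^- 6 *: delta_mx n1 p1 +
  q ^+ 3 *: delta_mx p2 n2 + q ^- 5 *: delta_mx n2 p2 +
  delta_mx p3 n3 + q ^- 2 *: delta_mx n3 p3 + delta_mx z0 z0.

Definition is_gamma (gamma : 'Hom('cV[K]_7, 'M[K]_7)) : Prop :=
  (forall g x, gamma (actV g *m x) = actVV g (gamma x)) /\
  gamma (vb p1) =
    delta_mx p1 z0 - q ^- 6 *: delta_mx z0 p1
    - (q ^- 3 + q^-1) *: (delta_mx p2 p3 - q ^- 3 *: delta_mx p3 p2).

Definition gcoef (gamma : 'Hom('cV[K]_7, 'M[K]_7)) (a r s : 'I_7) : K :=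
  gamma (vb a) r s.

Definition psi (gamma : 'Hom('cV[K]_7, 'M[K]_7)) (r s t : 'I_7) : K :=
  - q ^+ 3 * \sum_c phi r c * gcoef gamma c s t.

(* q^6 (id (x) gamma (x) gamma)(Psi) *)
Definition theta (gamma : 'Hom('cV[K]_7, 'M[K]_7)) (a b c d e : 'I_7) : K :=
  q ^+ 6 * \sum_s \sum_t
    psi gamma a s t * gcoef gamma s b c * gcoef gamma t d e.

Definition Phi (m : nat) (i j : 'I_m) : tpower :=
  \sum_a \sum_b phi a b *: bmul (X i a) (X j b).

Definition Psi (gamma : 'Hom('cV[K]_7, 'M[K]_7)) (m : nat)
    (i j k : 'I_m) : tpower :=
  \sum_r \sum_s \sum_t
    psi gamma r s t *: bmul (bmul (X i r) (X j s)) (X k t).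

Definition Theta (gamma : 'Hom('cV[K]_7, 'M[K]_7)) (m : nat)
    (i j r s t : 'I_m) : tpower :=
  \sum_a \sum_b \sum_c \sum_d \sum_e
    theta gamma a b c d e *:
      bmul (bmul (bmul (bmul (X i a) (X j b)) (X r c)) (X s d)) (X t e).

End G2.

(* Main.v *)
(** All five slots are distinct, so no relation of [S_q(V)] is used: the identity
already holds in [T(V)^{(x) m}], where it reads as an equality of vectors of
[V^{(x) 5}] with Laurent polynomial coefficients, to be checked by evaluation
once the braiding [RVV] and the map [gamma] are known explicitly.

The braiding is identified as follows.  The explicit operator [Rop] commutes
with the action of [U_q] and multiplies the highest weight vectors of weights
[2 lambda1], [lambda2], [lambda1], [0] by [q^2], [-1], [-q^-6], [q^-12].  A
highest weight vector is determined by its component in [V (x) v_1], so each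
highest weight space is a line and [Rop] is a scalar on each [V_mu].  These
scalars are distinct, and the [V_mu] span [V (x) V], so [Rop = RVV].  The map
[gamma] is determined by [gamma(v_1)], as [v_1] generates [V] under [F_1],
[F_2]. *)

Require Import Defs.
From HB Require Import structures.
From Stdlib Require Import ZArith.
From mathcomp Require Import all_boot all_order all_algebra.
From mathcomp Require Import finmap reals complex.
From mathcomp.multinomials Require Import monalg.
From mathcomp Require Import ssrZ.

Set Implicit Arguments.
Unset Strict Implicit.
Unset Printing Implicit Defensive.

Import GRing.Theory Num.Theory.
Local Open Scope ring_scope.
(** * Sparse linear combinations with Laurent polynomial coefficients *)

(* No order axioms: an unsorted list still evaluates correctly, it is only not
   in normal form. *)
Record keyCmp (T : Type) := KeyCmp {
  key_cmp :> T -> T -> comparison;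
  key_cmp_eq : forall x y, key_cmp x y = Eq -> x = y }.

(* The pair (c, e) stands for c q^e. *)
Definition laurent := seq (Z * Z).
Definition sparse (T : Type) := seq (laurent * T).

Section Merge.
Variables (C T : Type) (cmp : keyCmp T).
Variables (add : C -> C -> C) (iszero : C -> bool).

(** Entries whose coefficients cancel are dropped: a combination that vanishes becomes the empty
    list, and identities can be tested as equalities of lists. *)
Fixpoint merge_add (x : seq (C * T)) : seq (C * T) -> seq (C * T) :=
  fix aux (y : seq (C * T)) :=
  match x, y with
  | [::], _ => y
  | _, [::] => x
  | (c, k) :: x', (d, l) :: y' =>
      match cmp k l with
      | Lt => (c, k) :: merge_add x' y
      | Gt => (d, l) :: aux y'
      | Eq => let s := add c d in
              if iszero s then merge_add x' y' else (s, k) :: merge_add x' y'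
      end
  end.

(** The function [g] is arbitrary because two layers rely on this: integers keyed by exponents in
    [ladd], and Laurent polynomials keyed by basis elements in [sadd]. Coefficients are added only
    when the comparison returns [Eq], and then the keys coincide. *)
Lemma sum_merge_add (V : nmodType) (g : C * T -> V) (x y : seq (C * T)) :
    (forall c d k, g (add c d, k) = g (c, k) + g (d, k)) ->
    (forall c k, iszero c -> g (c, k) = 0) ->
  \sum_(m <- merge_add x y) g m = \sum_(m <- x) g m + \sum_(m <- y) g m.
Proof.
move=> gD g0; elim: x y => [|[c k] x IHx]; first by case=> [|p y]; rewrite big_nil add0r.
elim=> [|[d l] y IHy]; first by rewrite big_nil addr0.
rewrite /=; case Ecmp: (cmp k l).
- rewrite -(key_cmp_eq Ecmp); case: ifP => [/g0 s0|_].
    by rewrite IHx !big_cons addrACA -gD s0 add0r.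
  by rewrite !big_cons IHx gD addrACA.
- by rewrite !big_cons IHx big_cons addrA.
- by rewrite [LHS]big_cons IHy [in RHS]big_cons [in RHS]big_cons addrCA big_cons.
Qed.
End Merge.

Definition cmpZ := KeyCmp (fun x y => proj1 (Z.compare_eq_iff x y)).

Lemma cmp_ord_eq (n : nat) (a b : 'I_n) : Nat.compare a b = Eq -> a = b.
Proof. by move/PeanoNat.Nat.compare_eq_iff/val_inj. Qed.
Definition cmp_ord n := KeyCmp (@cmp_ord_eq n).

Section CmpPair.
Variables (T U : Type) (c : keyCmp T) (d : keyCmp U).
Definition pair_cmp (x y : T * U) : comparison :=
  if c x.1 y.1 is Eq then d x.2 y.2 else c x.1 y.1.
Lemma pair_cmp_eq x y : pair_cmp x y = Eq -> x = y.
Proof.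
rewrite /pair_cmp; case Ec: (c x.1 y.1) => // Ed.
by move: (key_cmp_eq Ec) (key_cmp_eq Ed); case: x y {Ec Ed} => [x1 x2] [y1 y2] /= -> ->.
Qed.
Definition cmp_pair := KeyCmp pair_cmp_eq.
End CmpPair.

Section CmpSeq.
Variables (T : Type) (c : keyCmp T).
Fixpoint seq_cmp (x y : seq T) : comparison :=
  match x, y with
  | [::], [::] => Eq
  | [::], _ => Lt
  | _, [::] => Gt
  | a :: x', b :: y' => if c a b is Eq then seq_cmp x' y' else c a b
  end.
Lemma seq_cmp_eq x y : seq_cmp x y = Eq -> x = y.
Proof.
elim: x y => [|a x IHx] [|b y] //=.
by case Ec: (c a b) => // /IHx ->; rewrite (key_cmp_eq Ec).
Qed.
Definition cmp_seq := KeyCmp seq_cmp_eq.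
End CmpSeq.

Definition ladd : laurent -> laurent -> laurent :=
  merge_add cmpZ Z.add (Z.eqb 0).
Definition lmul (p r : laurent) : laurent :=
  foldr (fun m acc => ladd [seq (Z.mul m.1 n.1, Z.add m.2 n.2) | n <- r] acc)
    [::] p.
Definition mon (c e : Z) : laurent := [:: (c, e)].

Definition sadd (T : Type) (cmp : keyCmp T) : sparse T -> sparse T -> sparse T :=
  merge_add cmp ladd (@nilp (Z * Z)).
Definition sscale (T : Type) (p : laurent) (x : sparse T) : sparse T :=
  [seq (lmul p m.1, m.2) | m <- x].
Definition sbind (T U : Type) (cmp : keyCmp U)
    (x : sparse T) (f : T -> sparse U) : sparse U :=
  foldr (fun m acc => sadd cmp (sscale m.1 (f m.2)) acc) [::] x.
Definition sunit (T : Type) (k : T) : sparse T := [:: (mon 1 0, k)].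

Section Eval.
Variables (K : fieldType) (q : K).

(** Coefficients and exponents are binary integers, for fast evaluation by [vm_compute]; [int_of_Z]
    carries them to the integers of the ring structures. *)
Definition Zval (c : Z) : K := (int_of_Z c)%:~R.
Definition Zpow (e : Z) : K := q ^ int_of_Z e.
Definition lev (p : laurent) : K := \sum_(m <- p) Zval m.1 * Zpow m.2.
Definition ev (L : lmodType K) (T : Type) (f : T -> L) (x : sparse T) : L :=
  \sum_(m <- x) lev m.1 *: f m.2.

Lemma lev_ladd p r : lev (ladd p r) = lev p + lev r.
Proof.
apply: sum_merge_add => [c d k|c k /Z.eqb_spec <-]; last by rewrite mul0r.
by rewrite -mulrDl -rmorphD -raddfD.
Qed.

Lemma lev_mon c e : lev (mon c e) = Zval c * Zpow e.
Proof. exact: big_seq1. Qed.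

Lemma lev_nil : lev [::] = 0.
Proof. exact: big_nil. Qed.

Section EvalTheory.
Variables (L : lmodType K) (T : Type) (f : T -> L).

Lemma ev_nil : ev f [::] = 0.
Proof. exact: big_nil. Qed.

Lemma ev_cons p k x : ev f ((p, k) :: x) = lev p *: f k + ev f x.
Proof. exact: big_cons. Qed.

Lemma ev_sunit k : ev f (sunit k) = f k.
Proof. by rewrite ev_cons ev_nil addr0 lev_mon mulr1 scale1r. Qed.

Lemma ev_sadd cmp x y : ev f (sadd cmp x y) = ev f x + ev f y.
Proof.
apply: sum_merge_add => [c d k|c k /nilP ->]; first by rewrite lev_ladd scalerDl.
by rewrite lev_nil scale0r.
Qed.

Lemma eq_ev (g : T -> L) x : f =1 g -> ev f x = ev g x.
Proof. by move=> fg; apply: eq_bigr => m _; rewrite fg. Qed.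

Lemma scaler_ev c x : c *: ev f x = ev (fun k => c *: f k) x.
Proof.
by rewrite scaler_sumr; apply: eq_bigr => m _; rewrite !scalerA mulrC.
Qed.

Lemma linear_ev (L' : lmodType K) (F : {linear L -> L'}) x :
  F (ev f x) = ev (F \o f) x.
Proof. by rewrite linear_sum; apply: eq_bigr => m _; rewrite linearZ. Qed.
End EvalTheory.

Hypothesis q0 : q != 0.

Lemma lev_lmul p r : lev (lmul p r) = lev p * lev r.
Proof.
elim: p => [|m p IHp]; first by rewrite [lmul _ _]/= !lev_nil mul0r.
rewrite [lmul _ _]/= lev_ladd IHp [lev (m :: p)]big_cons mulrDl; congr (_ + _).
rewrite /lev big_map mulr_sumr; apply: eq_bigr => n _ /=.
by rewrite /Zval /Zpow !rmorphM raddfD expfzDr // mulrACA.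
Qed.

Lemma ev_sscale (L : lmodType K) T (f : T -> L) p x :
  ev f (sscale p x) = lev p *: ev f x.
Proof.
rewrite /ev big_map scaler_sumr; apply: eq_bigr => m _ /=.
by rewrite lev_lmul scalerA.
Qed.

Lemma ev_sbind (L : lmodType K) T U cmp (f : U -> L) (x : sparse T) g :
  ev f (sbind cmp x g) = ev (fun k => ev f (g k)) x.
Proof.
elim: x => [|[p k] x IHx]; first by rewrite !ev_nil.
by rewrite [sbind _ _ _]/= ev_sadd ev_sscale IHx ev_cons.
Qed.
End Eval.

(** * The action on V and on V (x) V *)

Lemma ord7_ind (P : 'I_7 -> Prop) :
  P p1 -> P p2 -> P p3 -> P z0 -> P n3 -> P n2 -> P n1 -> forall a, P a.
Proof.
by move=> P0 P1 P2 P3 P4 P5 P6; case=> [[|[|[|[|[|[|[|//]]]]]]] lta];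
   rewrite (bool_irrelevance lta isT).
Qed.

Definition i1 : 'I_2 := @Ordinal 2 0 isT.
Definition i2 : 'I_2 := @Ordinal 2 1 isT.

Lemma ord2_ind (P : 'I_2 -> Prop) : P i1 -> P i2 -> forall i, P i.
Proof.
by move=> P0 P1; case=> [[|[|//]] lti]; rewrite (bool_irrelevance lti isT).
Qed.

Local Open Scope Z_scope.

Definition sE (i : 'I_2) (a : 'I_7) : sparse 'I_7 :=
  nth [::] (nth [::]
    [:: [:: [::]; [:: (mon 1 0, p1)]; [::]; [:: ([:: (1, -1); (1, 1)], p3)];
            [:: ([:: (-1, -1); (-1, 1)], z0)]; [::]; [:: (mon (-1) 0, n2)]];
        [:: [::]; [::]; [:: (mon 1 0, p2)]; [::]; [::];
            [:: (mon (-1) 0, n3)]; [::]]] i) a.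

Definition sF (i : 'I_2) (a : 'I_7) : sparse 'I_7 :=
  nth [::] (nth [::]
    [:: [:: [:: (mon 1 0, p2)]; [::]; [:: (mon 1 0, z0)];
            [:: (mon (-1) 0, n3)]; [::]; [:: (mon (-1) 0, n1)]; [::]];
        [:: [::]; [:: (mon 1 0, p3)]; [::]; [::]; [:: (mon (-1) 0, n2)];
            [::]; [::]]] i) a.

Definition Kweight (i : 'I_2) (a : 'I_7) : Z :=
  nth 0 (nth [::] [:: [:: 1; -1; 2; 0; -2; 1; -1];
                      [:: 0; 3; -3; 0; 3; -3; 0]] i) a.

Definition sact (g : Uq_gen) (a : 'I_7) : sparse 'I_7 :=
  match g with
  | gE i => sE i a
  | gF i => sF i a
  | gK i => [:: (mon 1 (Kweight i a), a)]
  | gKinv i => [:: (mon 1 (- Kweight i a), a)]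
  end.

Local Close Scope Z_scope.

Notation pairs := ('I_7 * 'I_7)%type.
Definition cmp2 : keyCmp pairs := cmp_pair (cmp_ord 7) (cmp_ord 7).

Definition stensor (x y : sparse 'I_7) : sparse pairs :=
  sbind cmp2 x (fun a => sbind cmp2 y (fun b => sunit (a, b))).

Definition sactVV (g : Uq_gen) (ab : pairs) : sparse pairs :=
  let '(a, b) := ab in
  match g with
  | gE i => sadd cmp2 (stensor (sE i a) (sact (gK i) b)) (stensor (sunit a) (sE i b))
  | gF i => sadd cmp2 (stensor (sF i a) (sunit b)) (stensor (sact (gKinv i) a) (sF i b))
  | gK i => stensor (sact (gK i) a) (sact (gK i) b)
  | gKinv i => stensor (sact (gKinv i) a) (sact (gKinv i) b)
  end.

Section Action.
Variables (K : fieldType) (q : K).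

Definition unit2 (ab : pairs) : 'M[K]_7 := delta_mx ab.1 ab.2.

Lemma arrow_vb (a b c : 'I_7) : arrow a b *m vb c = (a == c)%:R *: vb b :> 'cV[K]_7.
Proof.
rewrite /arrow /vb; case: eqVneq => [->|ac]; first by rewrite mul_delta_mx scale1r.
by rewrite mul_delta_mx_0 // scale0r.
Qed.

Lemma actK_vb i a : actK q i *m vb a = Zpow q (Kweight i a) *: vb a.
Proof.
apply/matrixP => r z; rewrite ord1 /actK mul_diag_mx !mxE.
case: eqP => [->|_]; last by rewrite !mulr0.
by congr (q ^ _ * _); elim/ord2_ind: i; elim/ord7_ind: a.
Qed.

Lemma actE_vb i a : actE q i *m vb a = ev q (@vb K) (sE i a).
Proof.
elim/ord2_ind: i; rewrite /actE /= ?(mulmxDl, mulmxBl, mulNmx) -?scalemxAl !arrow_vb;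
  elim/ord7_ind: a => /=;
  rewrite ?(scale0r, scaler0, subr0, addr0, add0r, scale1r, oppr0);
  rewrite /ev ?(big_cons, big_nil, lev_mon) /= ?addr0 /lev ?big_cons ?big_nil /= ?addr0;
  rewrite /Zval /Zpow /= ?mulr1 ?mul1r ?scale1r ?sub0r ?scaleN1r //.
- by rewrite addrC.
- by rewrite !mulN1r -opprD scaleNr addrC.
Qed.

Lemma actF_vb i a : actF i *m vb a = ev q (@vb K) (sF i a).
Proof.
elim/ord2_ind: i; rewrite /actF /= ?(mulmxDl, mulmxBl, mulNmx) -?scalemxAl !arrow_vb;
  elim/ord7_ind: a => /=;
  rewrite ?(scale0r, scaler0, subr0, addr0, add0r, scale1r, oppr0);
  by rewrite /ev ?(big_cons, big_nil, lev_mon) /= ?addr0 /Zval /Zpow /=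
             ?mulr1 ?scale1r ?sub0r ?scaleN1r.
Qed.

Hypothesis q0 : q != 0.

Lemma actK_unit i : actK q i \in unitmx.
Proof.
rewrite unitmxE det_diag unitfE prodf_seq_neq0; apply/allP => a _.
by rewrite mxE expfz_neq0.
Qed.

Lemma actKinv_vb i a :
  invmx (actK q i) *m vb a = Zpow q (- Kweight i a) *: vb a.
Proof.
apply: (can_inj (mulKmx (actK_unit i))).
rewrite mulKVmx ?actK_unit // -scalemxAr actK_vb scalerA /Zpow raddfN -expfzDr //.
by rewrite addNr scale1r.
Qed.

Lemma actV_vb g a : actV q g *m vb a = ev q (@vb K) (sact g a).
Proof.
case: g => i; rewrite /= ?actE_vb ?actF_vb ?actK_vb ?actKinv_vb // ev_cons ev_nil.
  by rewrite lev_mon mul1r addr0.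
by rewrite lev_mon mul1r addr0.
Qed.

(** The matrix [delta_mx a b] is the product of the column [v_a] and the row [v_b^T], so [A] and
    [B^T] act on separate factors. *)
Lemma tens_unit2 A B a b :
  tens A B (unit2 (a, b)) = (A *m vb a) *m (B *m vb b)^T :> 'M[K]_7.
Proof.
by rewrite lfunE /= /vb trmx_mul trmx_delta !mulmxA -(mulmxA A (delta_mx a 0)) mul_delta_mx.
Qed.

Lemma ev_stensor x y :
  ev q unit2 (stensor x y) = ev q (@vb K) x *m (ev q (@vb K) y)^T.
Proof.
rewrite ev_sbind // mulmx_suml; apply: eq_bigr => m _.
rewrite ev_sbind // -scalemxAl; congr (_ *: _).
rewrite [in RHS]/ev linear_sum mulmx_sumr; apply: eq_bigr => n _.
rewrite linearZ /= -scalemxAr; congr (_ *: _).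
by rewrite ev_sunit /unit2 /vb trmx_delta mul_delta_mx.
Qed.

Lemma actVV_unit2 g ab : actVV q g (unit2 ab) = ev q unit2 (sactVV g ab).
Proof.
case: ab => a b.
case: g => i; cbv beta iota delta [actVV sactVV];
  [rewrite add_lfunE ev_sadd|rewrite add_lfunE ev_sadd| | ]; rewrite !ev_stensor !tens_unit2 ?mul1mx
  -?[actE q i]/(actV q (gE i)) -?[actF i]/(actV q (gF i))
  -?[actK q i]/(actV q (gK i)) -?[invmx _]/(actV q (gKinv i)) ?actV_vb ?ev_sunit //.
Qed.
End Action.

(** * The braiding of V (x) V *)

Local Open Scope Z_scope.


(* The entry in row a and column b is the image of v_a (x) v_b. *)
Definition braiding_rows : seq (seq (sparse ('I_7 * 'I_7))) := [::
  [:: [:: ([:: (1, 2)], (p1, p1))];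
      [:: ([:: (1, 1)], (p2, p1))];
      [:: ([:: (1, 1)], (p3, p1))];
      [:: ([:: (1, 0)], (z0, p1))];
      [:: ([:: (1, -1)], (n3, p1))];
      [:: ([:: (1, -1)], (n2, p1))];
      [:: ([:: (1, -2)], (n1, p1))]];
  [:: [:: ([:: (1, 1)], (p1, p2)); ([:: (-1, 0); (1, 2)], (p2, p1))];
      [:: ([:: (1, 2)], (p2, p2))];
      [:: ([:: (1, -1)], (p3, p2)); ([:: (-1, -1); (1, 1)], (z0, p1))];
      [:: ([:: (1, 0)], (z0, p2)); ([:: (1, -2); (-1, 0)], (n3, p1))];
      [:: ([:: (1, 1)], (n3, p2))];
      [:: ([:: (1, -2)], (n2, p2)); ([:: (1, -3); (-1, -1)], (n1, p1))];
      [:: ([:: (1, -1)], (n1, p2))]];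
  [:: [:: ([:: (1, 1)], (p1, p3)); ([:: (-1, 0); (1, 2)], (p3, p1))];
      [:: ([:: (1, -1)], (p2, p3)); ([:: (-1, -4); (1, 2)], (p3, p2));
          ([:: (1, -4); (-1, -2)], (z0, p1))];
      [:: ([:: (1, 2)], (p3, p3))];
      [:: ([:: (1, 0)], (z0, p3)); ([:: (-1, -2); (1, 0)], (n2, p1))];
      [:: ([:: (1, -2)], (n3, p3)); ([:: (1, -5); (-1, 1)], (n2, p2));
          ([:: (1, -6); (-1, -4)], (n1, p1))];
      [:: ([:: (1, 1)], (n2, p3))];
      [:: ([:: (1, -1)], (n1, p3))]];
  [:: [:: ([:: (1, 0)], (p1, z0)); ([:: (-1, -3); (1, 1)], (p2, p3));
          ([:: (1, -6); (-1, -2)], (p3, p2));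
          ([:: (-1, -6); (1, -4); (-1, 0); (1, 2)], (z0, p1))];
      [:: ([:: (1, 0)], (p2, z0)); ([:: (-1, -2); (1, 2)], (z0, p2));
          ([:: (-1, -4); (1, -2)], (n3, p1))];
      [:: ([:: (1, 0)], (p3, z0)); ([:: (-1, -2); (1, 2)], (z0, p3));
          ([:: (1, -4); (-1, -2)], (n2, p1))];
      [:: ([:: (1, 0)], (z0, z0)); ([:: (1, -4); (-1, 0)], (n3, p3));
          ([:: (1, -7); (-1, -3)], (n2, p2));
          ([:: (1, -8); (-1, -6); (1, -2); (-1, 0)], (n1, p1))];
      [:: ([:: (1, 0)], (n3, z0)); ([:: (-1, -3); (1, 1)], (n1, p2))];
      [:: ([:: (1, 0)], (n2, z0)); ([:: (1, -3); (-1, 1)], (n1, p3))];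
      [:: ([:: (1, 0)], (n1, z0))]];
  [:: [:: ([:: (1, -1)], (p1, n3)); ([:: (1, -2); (-1, 2)], (p2, z0));
          ([:: (-1, -4); (1, 0)], (z0, p2));
          ([:: (-1, -6); (1, -2); (-1, 0); (1, 2)], (n3, p1))];
      [:: ([:: (1, 1)], (p2, n3)); ([:: (-1, 0); (1, 2)], (n3, p2))];
      [:: ([:: (1, -2)], (p3, n3)); ([:: (1, -2); (-1, 2)], (z0, z0));
          ([:: (1, -4); (-1, -2); (-1, 0); (1, 2)], (n3, p3));
          ([:: (1, -7); (-1, -5)], (n2, p2));
          ([:: (1, -8); (-1, -6); (1, -4); (-1, 0)], (n1, p1))];
      [:: ([:: (1, 0)], (z0, n3)); ([:: (-1, -2); (1, 2)], (n3, z0));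
          ([:: (1, -5); (-1, -1)], (n1, p2))];
      [:: ([:: (1, 2)], (n3, n3))];
      [:: ([:: (1, -1)], (n2, n3)); ([:: (-1, -2); (1, 2)], (n1, z0))];
      [:: ([:: (1, 1)], (n1, n3))]];
  [:: [:: ([:: (1, -1)], (p1, n2)); ([:: (-1, -2); (1, 2)], (p3, z0));
          ([:: (1, -4); (-1, 0)], (z0, p3));
          ([:: (-1, -6); (1, -2); (-1, 0); (1, 2)], (n2, p1))];
      [:: ([:: (1, -2)], (p2, n2)); ([:: (1, -5); (-1, 1)], (p3, n3));
          ([:: (1, -5); (-1, -1)], (z0, z0)); ([:: (1, -7); (-1, -5)], (n3, p3));
          ([:: (1, -10); (-1, -8); (-1, 0); (1, 2)], (n2, p2));
          ([:: (1, -11); (-1, -9); (1, -7); (-1, -3)], (n1, p1))];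
      [:: ([:: (1, 1)], (p3, n2)); ([:: (-1, 0); (1, 2)], (n2, p3))];
      [:: ([:: (1, 0)], (z0, n2)); ([:: (-1, -2); (1, 2)], (n2, z0));
          ([:: (-1, -5); (1, -1)], (n1, p3))];
      [:: ([:: (1, -1)], (n3, n2)); ([:: (-1, -4); (1, 2)], (n2, n3));
          ([:: (1, -5); (-1, -1)], (n1, z0))];
      [:: ([:: (1, 2)], (n2, n2))];
      [:: ([:: (1, 1)], (n1, n2))]];
  [:: [:: ([:: (1, -2)], (p1, n1)); ([:: (1, -3); (-1, -1)], (p2, n2));
          ([:: (1, -6); (-1, -4)], (p3, n3));
          ([:: (1, -6); (-1, -4); (1, 0); (-1, 2)], (z0, z0));
          ([:: (1, -8); (-1, -6); (1, -4); (-1, 0)], (n3, p3));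
          ([:: (1, -11); (-1, -9); (1, -7); (-1, -3)], (n2, p2));
          ([:: (1, -12); (-1, -10); (1, -8); (-1, -6); (-1, -4); (1, -2);
          (-1, 0); (1, 2)], (n1, p1))];
      [:: ([:: (1, -1)], (p2, n1)); ([:: (-1, -1); (1, 1)], (z0, n3));
          ([:: (1, -3); (-1, -1)], (n3, z0));
          ([:: (-1, -6); (1, -2); (-1, 0); (1, 2)], (n1, p2))];
      [:: ([:: (1, -1)], (p3, n1)); ([:: (1, -1); (-1, 1)], (z0, n2));
          ([:: (-1, -3); (1, -1)], (n2, z0));
          ([:: (-1, -6); (1, -2); (-1, 0); (1, 2)], (n1, p3))];
      [:: ([:: (1, 0)], (z0, n1)); ([:: (-1, -2); (1, 0)], (n3, n2));
          ([:: (1, -5); (-1, -3)], (n2, n3));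
          ([:: (-1, -6); (1, -4); (-1, 0); (1, 2)], (n1, z0))];
      [:: ([:: (1, 1)], (n3, n1)); ([:: (-1, 0); (1, 2)], (n1, n3))];
      [:: ([:: (1, 1)], (n2, n1)); ([:: (-1, 0); (1, 2)], (n1, n2))];
      [:: ([:: (1, 2)], (n1, n1))]]].

(** Lowering operators suffice as sources: the certificate below reaches all of V (x) V from the
    four highest weight vectors by F_1 and F_2 alone. *)
Inductive source := SrcF of 'I_2 & 'I_7 & 'I_7 | SrcV of 'I_7 & 'I_7 | SrcH of nat.

(* A step (ab, d, s) asserts that d times the basis vector ab is the combination
   s of vectors already known to lie in the sum of the V_mu. *)
Definition spanning_steps : seq (pairs * laurent * sparse source) :=
  [:: ((p1, p1), mon 1 0, [:: (mon 1 0, SrcH 0)]);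
    ((p2, p1), [:: (1, 0); (1, 2)], [:: (mon 1 2, SrcF i1 p1 p1);
        (mon 1 0, SrcH 1)]);
    ((p1, p2), mon 1 0, [:: (mon 1 1, SrcF i1 p1 p1); (mon (-1) 1, SrcV p2 p1)]);
    ((p2, p2), mon 1 0, [:: (mon 1 0, SrcF i1 p1 p2)]);
    ((p1, p3), mon 1 0, [:: (mon 1 0, SrcF i2 p1 p2)]);
    ((p3, p1), mon 1 0, [:: (mon 1 0, SrcF i2 p2 p1)]);
    ((z0, p1), [:: (1, 0); (1, 2); (1, 4); (1, 8); (1, 10);
        (1, 12)], [:: (mon 1 7, SrcF i1 p1 p3);
        ([:: (1, 2); (1, 4); (1, 8); (1, 10); (1, 12)], SrcF i1 p3 p1);
        ([:: (-1, 6); (-1, 8); (-1, 10)], SrcF i2 p2 p2); (mon 1 0, SrcH 2)]);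
    ((p3, p2), mon 1 0, [:: (mon 1 2, SrcF i1 p3 p1); (mon (-1) 2, SrcV z0 p1)]);
    ((p2, p3), mon 1 0, [:: (mon 1 3, SrcF i2 p2 p2); (mon (-1) 3, SrcV p3 p2)]);
    ((p1, z0), mon 1 0, [:: (mon 1 1, SrcF i1 p1 p3); (mon (-1) 1, SrcV p2 p3)]);
    ((p2, z0), mon 1 0, [:: (mon 1 (-1), SrcF i1 p2 p3)]);
    ((z0, p2), mon 1 0, [:: (mon 1 0, SrcF i1 p3 p2)]);
    ((p1, n3), mon 1 0, [:: (mon (-1) 1, SrcF i1 p1 z0); (mon 1 1, SrcV p2 z0)]);
    ((n3, p1), mon 1 0, [:: (mon (-1) 0, SrcF i1 z0 p1); (mon 1 0, SrcV z0 p2)]);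
    ((p3, p3), mon 1 0, [:: (mon 1 0, SrcF i2 p2 p3)]);
    ((p2, n3), mon 1 0, [:: (mon 1 0, SrcF i1 p1 n3)]);
    ((n3, p2), mon 1 0, [:: (mon (-1) 0, SrcF i1 z0 p2)]);
    ((p1, n2), mon 1 0, [:: (mon (-1) 0, SrcF i2 p1 n3)]);
    ((p3, z0), mon 1 0, [:: (mon 1 0, SrcF i2 p2 z0)]);
    ((z0, p3), mon 1 0, [:: (mon 1 0, SrcF i2 z0 p2)]);
    ((n2, p1), mon 1 0, [:: (mon (-1) 0, SrcF i2 n3 p1)]);
    ((n1, p1), [:: (1, 0); (1, 2); (1, 8); (1, 10); (1, 12); (1, 18);
        (1, 20)], [:: (mon 1 11, SrcF i1 p1 n2);
        ([:: (1, 8); (1, 14); (1, 16)], SrcF i1 p3 z0);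
        ([:: (-1, 6); (-1, 8); (-1, 14); (-1, 16)], SrcF i1 z0 p3);
        ([:: (-1, 2); (-1, 8); (-1, 10); (-1, 12); (-1, 18);
        (-1, 20)], SrcF i1 n2 p1); ([:: (1, 12); (1, 14)], SrcF i2 p2 n3);
        ([:: (-1, 7); (-1, 9); (-1, 11); (-1, 17); (-1, 19)], SrcF i2 n3 p2);
        (mon 1 0, SrcH 3)]);
    ((n2, p2), mon 1 0, [:: (mon 1 1, SrcF i1 n2 p1); (mon 1 1, SrcV n1 p1)]);
    ((n3, p3), mon 1 0, [:: (mon 1 3, SrcF i2 n3 p2); (mon 1 3, SrcV n2 p2)]);
    ((z0, z0), mon 1 0, [:: (mon 1 0, SrcF i1 z0 p3); (mon 1 0, SrcV n3 p3)]);
    ((p3, n3), mon 1 0, [:: (mon (-1) 2, SrcF i1 p3 z0); (mon 1 2, SrcV z0 z0)]);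
    ((p2, n2), mon 1 0, [:: (mon (-1) 3, SrcF i2 p2 n3); (mon 1 3, SrcV p3 n3)]);
    ((p1, n1), mon 1 0, [:: (mon (-1) 1, SrcF i1 p1 n2); (mon 1 1, SrcV p2 n2)]);
    ((p2, n1), mon 1 0, [:: (mon 1 0, SrcF i1 p1 n1)]);
    ((z0, n3), mon 1 0, [:: (mon 1 0, SrcF i1 p3 n3)]);
    ((n3, z0), mon 1 0, [:: (mon 1 (-2), SrcF i1 n3 p3)]);
    ((n1, p2), mon 1 0, [:: (mon (-1) 0, SrcF i1 n2 p2)]);
    ((p3, n2), mon 1 0, [:: (mon 1 0, SrcF i2 p2 n2)]);
    ((n2, p3), mon 1 0, [:: (mon (-1) 0, SrcF i2 n3 p3)]);
    ((n3, n3), mon 1 0, [:: (mon (-1) 0, SrcF i1 z0 n3)]);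
    ((p3, n1), mon 1 0, [:: (mon 1 0, SrcF i2 p2 n1)]);
    ((z0, n2), mon 1 0, [:: (mon (-1) 0, SrcF i2 z0 n3)]);
    ((n2, z0), mon 1 0, [:: (mon (-1) 0, SrcF i2 n3 z0)]);
    ((n1, p3), mon 1 0, [:: (mon 1 0, SrcF i2 n1 p2)]);
    ((z0, n1), mon 1 0, [:: (mon 1 0, SrcF i1 p3 n1)]);
    ((n1, z0), mon 1 0, [:: (mon 1 (-1), SrcF i1 n1 p3)]);
    ((n3, n2), mon 1 0, [:: (mon (-1) 0, SrcF i1 z0 n2); (mon (-1) 0, SrcV z0 n1)]);
    ((n2, n3), mon 1 0, [:: (mon (-1) 1, SrcF i1 n2 z0); (mon (-1) 1, SrcV n1 z0)]);
    ((n3, n1), mon 1 0, [:: (mon (-1) 0, SrcF i1 z0 n1)]);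
    ((n1, n3), mon 1 0, [:: (mon (-1) 0, SrcF i1 n2 n3)]);
    ((n2, n2), mon 1 0, [:: (mon (-1) 0, SrcF i2 n3 n2)]);
    ((n2, n1), mon 1 0, [:: (mon (-1) 0, SrcF i2 n3 n1)]);
    ((n1, n2), mon 1 0, [:: (mon (-1) 0, SrcF i2 n1 n3)]);
    ((n1, n1), mon 1 0, [:: (mon (-1) 0, SrcF i1 n2 n1)])].

(* The k-th vector has weight nth 0 VV_weights k. *)
Definition shw : seq (sparse pairs) :=
  [:: sunit (p1, p1);
      [:: (mon (-1) 1, (p1, p2)); (mon 1 0, (p2, p1))];
      [:: (mon (-1) 6, (p1, z0)); ([:: (1, 3); (1, 5)], (p2, p3));
          ([:: (-1, 0); (-1, 2)], (p3, p2)); (mon 1 0, (z0, p1))];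
      [:: (mon 1 10, (p1, n1)); (mon 1 9, (p2, n2)); (mon 1 6, (p3, n3));
          (mon 1 6, (z0, z0)); (mon 1 4, (n3, p3)); (mon 1 1, (n2, p2));
          (mon 1 0, (n1, p1))]].

Definition shw_eigenvalue : seq laurent :=
  [:: mon 1 2; mon (-1) 0; mon (-1) (-6); mon 1 (-12)].

Local Close Scope Z_scope.

Definition sRVV (ab : pairs) : sparse pairs :=
  nth [::] (nth [::] braiding_rows ab.1) ab.2.

Lemma sRVV_sactVV g ab :
  sbind cmp2 (sactVV g ab) sRVV = sbind cmp2 (sRVV ab) (sactVV g).
Proof.
case: ab => a b; case: g => i; elim/ord2_ind: i; elim/ord7_ind: a;
  by elim/ord7_ind: b; vm_compute.
Qed.

Lemma sRVV_shw k : (k < 4)%N ->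
  sbind cmp2 (nth [::] shw k) sRVV =
  sscale (nth [::] shw_eigenvalue k) (nth [::] shw k).
Proof. by case: k => [|[|[|[|//]]]] _; vm_compute. Qed.

Lemma sactE_shw i k : (k < 4)%N -> sbind cmp2 (nth [::] shw k) (sactVV (gE i)) = [::].
Proof. by elim/ord2_ind: i; case: k => [|[|[|[|//]]]] _; vm_compute. Qed.

Lemma sactK_shw i k : (k < 4)%N ->
  sbind cmp2 (nth [::] shw k) (sactVV (gK i)) =
  sscale (mon 1 (Z_of_int (pairing (nth 0 VV_weights k) i))) (nth [::] shw k).
Proof. by elim/ord2_ind: i; case: k => [|[|[|[|//]]]] _; vm_compute. Qed.

Definition source_val (s : source) : sparse pairs :=
  match s with
  | SrcF i a b => sactVV (gF i) (a, b)
  | SrcV a b => sunit (a, b)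
  | SrcH k => nth [::] shw k
  end.

Definition source_ok (known : seq pairs) (s : source) : bool :=
  match s with
  | SrcF _ a b | SrcV a b => (a, b) \in known
  | SrcH k => (k < 4)%N
  end.

(** A decidable sufficient condition for a pivot of [spanning_steps] to be invertible: [d] has no
    negative exponent, and its value at 1, the sum of its coefficients, is nonzero. *)
Definition nonzero_at1 (d : laurent) : bool :=
  all (fun m => (0 <= int_of_Z m.2)%R) d && (foldr (fun m => Z.add m.1) Z0 d != Z0).

Definition letters : seq 'I_7 := [:: p1; p2; p3; z0; n3; n2; n1].

Fixpoint spans_from (known : seq pairs) (steps : seq (pairs * laurent * sparse source)) :=
  if steps is (ab, d, s) :: steps' then
    [&& all (fun m => source_ok known m.2) s,
        sbind cmp2 s source_val == [:: (d, ab)], nonzero_at1 d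
      & spans_from (ab :: known) steps']
  else all (fun ab => ab \in known) [seq (a, b) | a <- letters, b <- letters].

Lemma spanning_steps_ok : spans_from [::] spanning_steps.
Proof. by vm_compute. Qed.

(** * Linear extension from basis tensors, sums of eigenspaces, stationary chains of subspaces *)

Section LinearExtension.
Variables (K : fieldType) (L : lmodType K) (g : pairs -> L).

Definition lext (M : 'M[K]_7) : L := \sum_a \sum_b M a b *: g (a, b).

Lemma lext_is_linear : linear lext.
Proof.
move=> c M N; rewrite scaler_sumr -big_split; apply: eq_bigr => a _ /=.
rewrite scaler_sumr -big_split; apply: eq_bigr => b _ /=.
by rewrite !mxE scalerDl scalerA.
Qed.
HB.instance Definition _ :=
  GRing.isLinear.Build K 'M[K]_7 L _ lext lext_is_linear.

Lemma lext_unit2 ab : lext (unit2 K ab) = g ab.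
Proof.
case: ab => a b; rewrite /lext (bigD1 a) //= (bigD1 b) //= mxE !eqxx scale1r.
rewrite !big1 ?addr0 // => [c ca|c cb]; last by rewrite mxE (negPf cb) andbF scale0r.
by rewrite big1 // => d _; rewrite mxE (negPf ca) scale0r.
Qed.

Lemma linear_lext (F : {linear 'M[K]_7 -> L}) M :
  (forall ab, F (unit2 K ab) = g ab) -> F M = lext M.
Proof.
move=> Fg; rewrite {1}(matrix_sum_delta M) linear_sum; apply: eq_bigr => a _.
by rewrite linear_sum; apply: eq_bigr => b _; rewrite linearZ -Fg.
Qed.
End LinearExtension.

Lemma unit2_ext (K : fieldType) (L : lmodType K) (F G : {linear 'M[K]_7 -> L}) :
  (forall ab, F (unit2 K ab) = G (unit2 K ab)) -> F =1 G.
Proof. by move=> FG M; rewrite (linear_lext M FG); apply/esym/linear_lext. Qed.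

Section EigenSum.
Variables (K : fieldType) (V : vectType K) (T : 'End(V)).
Variables (I : eqType) (W : I -> {vspace V}) (c : I -> K).
Implicit Types (r : seq I) (P : pred I) (x : V).

Lemma sumv_eigen_stable r P x :
    (forall i, i \in r -> forall y, y \in W i -> T y = c i *: y) ->
  x \in (\sum_(i <- r | P i) W i)%VS -> T x \in (\sum_(i <- r | P i) W i)%VS.
Proof.
elim: r x => [|i r IHr] x eigW; first by rewrite big_nil !memv0 => /eqP->; rewrite linear0.
have eig_r j (jr : j \in r) := eigW j (mem_behead (s := i :: r) jr).
rewrite big_cons; case: ifP => _; last exact: IHr.
case/memv_addP=> y Wy [z Wz ->]; rewrite linearD memv_add ?IHr //=.
by rewrite (eigW i) ?mem_head // memvZ.
Qed.

(** An eigenvector for [a] cannot lie in a sum of eigenspaces for other eigenvalues. The summands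
    are peeled off one at a time: removing [W i] keeps [x] in the sum of the remaining ones. *)
Lemma sumv_eigen_eq0 r P a x :
    (forall i, i \in r -> forall y, y \in W i -> T y = c i *: y) ->
    (forall i, i \in r -> P i -> c i != a) ->
  T x = a *: x -> x \in (\sum_(i <- r | P i) W i)%VS -> x = 0.
Proof.
move=> + + Tx; elim: r => [|i r IHr]; first by rewrite big_nil memv0 => _ _ /eqP.
move=> eigW ca; have eig_r j (jr : j \in r) := eigW j (mem_behead (s := i :: r) jr).
have {}IHr := IHr eig_r (fun j jr => ca j (mem_behead (s := i :: r) jr)).
rewrite big_cons; case: ifP => // Pi.
case/memv_addP=> y Wy [z Wz Dx]; apply: IHr.
(* Applying [T - c i] to [x = y + z] kills [y] and multiplies [x] by [a - c i], which is
   invertible. *)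
have Dac : (a - c i) *: x = T z - c i *: z.
  rewrite scalerBl -Tx Dx linearD /= (eigW i) ?mem_head // scalerDr opprD addrACA.
  by rewrite subrr add0r.
have ac : a - c i != 0 by rewrite subr_eq0 eq_sym ca ?mem_head.
rewrite -[x](scalerK ac) Dac memvZ // memvB ?memvZ //.
exact: sumv_eigen_stable.
Qed.
End EigenSum.

(** While the chain grows, its dimension increases by at least one, so after [k] steps it is
    stationary or has dimension at least [k]. For [k] the dimension of the whole space, the second
    case gives the full space, which [f] fixes. *)
Lemma iter_vspace_stationary (K : fieldType) (V : vectType K)
    (f : {vspace V} -> {vspace V}) (U : {vspace V}) :
    (forall W, W <= f W)%VS ->
  let n := \dim {:V} in f (iter n f U) = iter n f U.
Proof.
move=> le_f n.
have step k : f (iter k f U) = iter k f U \/ (k <= \dim (iter k f U))%N.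
  elim: k => [|k [eq_k|le_k]]; first by right.
    by left; rewrite /= !eq_k.
  have [eq_k|neq_k] := eqVneq (f (iter k f U)) (iter k f U).
    by left; rewrite /= !eq_k.
  right; apply: leq_ltn_trans le_k _.
  by rewrite (ltn_leqif (dimv_leqif_eq (le_f _))) eq_sym.
have [//|n_le] := step n.
have full : iter n f U = fullv by apply/eqP; rewrite eqEdim subvf.
by apply/eqP; rewrite full eqEsubv subvf le_f.
Qed.

(** * Identification of the braiding with its explicit table, for q transcendental over the
    integers *)

Section Braiding.
Variables (K : fieldType) (q : K).
Hypothesis q_transc : forall p : {poly int}, p != 0 -> (map_poly intr p).[q] != 0.

Lemma q_neq0 : q != 0.
Proof.
have /q_transc : 'X != 0 :> {poly int} by rewrite polyX_eq0.
by rewrite map_polyX hornerX.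
Qed.
Let q0 := q_neq0.

Lemma q_expz_eq1 (n : int) : (q ^ n == 1) = (n == 0).
Proof.
have q1 k : q ^+ k.+1 != 1.
  rewrite -subr_eq0; have := q_transc (monic_neq0 (monicXnsubC 1 (ltn0Sn k))).
  by rewrite rmorphB /= map_polyXn map_polyC /= !hornerE.
case: n => [[|k]|k] //; rewrite ?expr0z ?eqxx //; first exact: (negPf (q1 k)).
by rewrite NegzE -invr_expz invr_eq1; apply: (negPf (q1 k)).
Qed.

(** Powers of [q] thus separate the weights, as eigenvalues of the K_i, and later the eigenvalues of
    [Rop]. *)
Lemma q_expz_inj : injective (exprz q).
Proof.
move=> m n /eqP; rewrite -(inj_eq (mulIf (expfz_neq0 (- n) q0))) -!expfzDr //.
by rewrite subrr expr0z q_expz_eq1 subr_eq0 => /eqP.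
Qed.

Lemma lev_neq0 d : nonzero_at1 d -> lev q d != 0.
Proof.
case/andP=> d_ge0 d1.
pose p : {poly int} := \sum_(m <- d) (int_of_Z m.1)%:P * 'X^`|int_of_Z m.2|%N.
(* A zero polynomial would vanish at 1, against the coefficient sum recorded by [nonzero_at1]. *)
have p_neq0 : p != 0.
  apply: contraNneq d1 => p0; have : p.[1] = 0 by rewrite p0 horner0.
  rewrite horner_sum => Dp; apply/eqP/(can_inj int_of_ZK); rewrite -[RHS]Dp.
  elim: (d) => [|m s IHs]; first by rewrite big_nil.
  by rewrite big_cons !hornerE expr1n mulr1 -IHs -raddfD.
have := q_transc p_neq0; rewrite rmorph_sum horner_sum /=.
suff -> : \sum_(m <- d) (map_poly intr ((int_of_Z m.1)%:P * 'X^`|int_of_Z m.2|%N)).[q]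
            = lev q d by [].
rewrite /lev !big_seq; apply: eq_bigr => m /(allP d_ge0) m_ge0.
rewrite rmorphM /= map_polyXn map_polyC !hornerE /Zval /Zpow; congr (_ * _).
by rewrite -{2}(gez0_abs m_ge0).
Qed.

(** Otherwise q^2 = -1, hence q^4 = 1. This coefficient of E_1 has to be cancelled in
    [hw_column1_eq0]. *)
Lemma q_add_qinv_neq0 : q + q^-1 != 0.
Proof.
apply/eqP => /(congr1 ( *%R q)); rewrite mulrDr divff // mulr0 => /eqP.
rewrite addr_eq0 -expr2 => /eqP q2; have := q_expz_eq1 4.
by rewrite -exprnP (exprM q 2 2) q2 sqrrN expr1n eqxx.
Qed.

Definition hw (k : nat) : 'M[K]_7 := ev q (unit2 K) (nth [::] shw k).

Lemma sbind_linear (F : {linear 'M[K]_7 -> 'M[K]_7}) x f :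
  (forall ab, F (unit2 K ab) = ev q (unit2 K) (f ab)) ->
  F (ev q (unit2 K) x) = ev q (unit2 K) (sbind cmp2 x f).
Proof. by move=> Ff; rewrite linear_ev ev_sbind //; apply: eq_ev. Qed.

Lemma actVV_ev g x :
  actVV q g (ev q (unit2 K) x) = ev q (unit2 K) (sbind cmp2 x (sactVV g)).
Proof. by apply: sbind_linear => ab; apply: actVV_unit2. Qed.

Definition Rop : 'End('M[K]_7) := linfun (lext (fun ab => ev q (unit2 K) (sRVV ab))).

Lemma Rop_unit2 ab : Rop (unit2 K ab) = ev q (unit2 K) (sRVV ab).
Proof. by rewrite lfunE /= lext_unit2. Qed.

Lemma Rop_ev x : Rop (ev q (unit2 K) x) = ev q (unit2 K) (sbind cmp2 x sRVV).
Proof. by apply: sbind_linear => ab; apply: Rop_unit2. Qed.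

Lemma Rop_actVV g M : Rop (actVV q g M) = actVV q g (Rop M).
Proof.
have := unit2_ext (F := Rop \o actVV q g) (G := actVV q g \o Rop) _ M; apply => ab /=.
by rewrite actVV_unit2 // Rop_unit2 Rop_ev actVV_ev sRVV_sactVV.
Qed.

Definition Reigen (k : nat) : K := lev q (nth [::] shw_eigenvalue k).

Lemma Rop_hw k : (k < 4)%N -> Rop (hw k) = Reigen k *: hw k.
Proof. by move=> k4; rewrite Rop_ev sRVV_shw // ev_sscale. Qed.

Lemma hw_mem k : (k < 4)%N -> hw k \in highest_weight_space q (nth 0 VV_weights k).
Proof.
move=> k4; rewrite memvE; apply/subv_bigcapP => i _; rewrite -memvE memv_cap.
rewrite !memv_ker /hw actVV_ev sactE_shw // ev_nil eqxx.
rewrite add_lfunE opp_lfunE scale_lfunE id_lfunE actVV_ev sactK_shw //.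
by rewrite ev_sscale // lev_mon mul1r /Zpow Z_of_intK subrr eqxx.
Qed.

(** The vector [M *m vb a] is the component of [M] in V (x) v_a. The equation E_i M = 0 reads E M
    K^T + M E^T = 0. Applied to [vb a], its first term is a multiple of E M v_a, since K is
    diagonal, and so vanishes; what remains is c M v_b = 0. *)
Lemma actE_tr_vb (i : 'I_2) (a b : 'I_7) (c : K) :
  c != 0 -> (actE q i)^T *m vb a = c *: vb b ->
  forall M, actVV q (gE i) M = 0 -> M *m vb a = 0 -> M *m vb b = 0.
Proof.
move=> c0 tr_a M; rewrite /actVV add_lfunE !lfunE /= mul1mx => EM Ma.
apply: (scalerI c0); rewrite scaler0 scalemxAr -tr_a.
have := congr1 (mulmx^~ (vb a)) EM.
rewrite /= mul0mx mulmxDl -!mulmxA tr_diag_mx actK_vb -!scalemxAr Ma mulmx0 scaler0.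
by rewrite add0r.
Qed.

(* From the component along v_a, the equation E_i M = 0 yields the component along
   v_b when E_i v_b is a multiple of v_a: this reaches every b from p1. *)
Lemma hw_column1_eq0 M :
  (forall i, actVV q (gE i) M = 0) -> M *m vb p1 = 0 -> M = 0.
Proof.
move=> EM M1.
have trE1 : (actE q i1)^T =
    arrow p1 p2 + (q + q^-1) *: arrow p3 z0 - (q + q^-1) *: arrow z0 n3 - arrow n2 n1.
  by apply/matrixP => r s; rewrite !mxE /= !(andbC (s == _)).
have trE2 : (actE q i2)^T = arrow p2 p3 - arrow n3 n2.
  by apply/matrixP => r s; rewrite !mxE /= !(andbC (s == _)).
have simp0 := (scale0r, scaler0, subr0, addr0, add0r, scale1r, oppr0, sub0r).
have step i a b c : (actE q i)^T *m vb a = c *: vb b -> c != 0 ->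
    M *m vb a = 0 -> M *m vb b = 0.
  by move=> tr_a c0; apply: actE_tr_vb c0 tr_a M (EM i).
have M2 : M *m vb p2 = 0.
  apply: (step i1 p1 _ 1) M1; rewrite ?oner_neq0 // trE1.
  by rewrite !(mulmxDl, mulNmx) -!scalemxAl !arrow_vb /= !simp0.
have M3 : M *m vb p3 = 0.
  apply: (step i2 p2 _ 1) M2; rewrite ?oner_neq0 // trE2.
  by rewrite !(mulmxDl, mulNmx) !arrow_vb /= !simp0.
have M0 : M *m vb z0 = 0.
  apply: (step i1 p3 _ (q + q^-1)) M3; rewrite ?q_add_qinv_neq0 // trE1.
  by rewrite !(mulmxDl, mulNmx) -!scalemxAl !arrow_vb /= !simp0.
have M3' : M *m vb n3 = 0.
  apply: (step i1 z0 _ (- (q + q^-1))) M0; rewrite ?oppr_eq0 ?q_add_qinv_neq0 // trE1.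
  by rewrite !(mulmxDl, mulNmx) -!scalemxAl !arrow_vb /= !simp0 scaleNr.
have M2' : M *m vb n2 = 0.
  apply: (step i2 n3 _ (- 1)) M3'; rewrite ?oppr_eq0 ?oner_neq0 // trE2.
  by rewrite !(mulmxDl, mulNmx) !arrow_vb /= !simp0 scaleN1r.
have M1' : M *m vb n1 = 0.
  apply: (step i1 n2 _ (- 1)) M2'; rewrite ?oppr_eq0 ?oner_neq0 // trE1.
  by rewrite !(mulmxDl, mulNmx) -!scalemxAl !arrow_vb /= !simp0 scaleN1r.
apply/matrixP => a b; rewrite [RHS]mxE.
suff /matrixP/(_ a 0) : M *m vb b = 0 by rewrite -colE !mxE.
by elim/ord7_ind: b.
Qed.

(** A nonzero entry at v_a (x) v_1 forces v_a to have weight mu - lambda1. The seven weights of V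
    are distinct, which leaves v_1, v_2, v_0, v_{-1} for the four values of mu. *)
Lemma hw_entry_eq0 k a M : (k < 4)%N ->
  M \in highest_weight_space q (nth 0 VV_weights k) ->
  a != nth p1 [:: p1; p2; z0; n1] k -> M a p1 = 0.
Proof.
move=> k4; rewrite memvE => /subv_bigcapP Mhw.
have KM i : q ^ (int_of_Z (Kweight i a) + int_of_Z (Kweight i p1)) * M a p1 =
            q ^ pairing (nth 0 VV_weights k) i * M a p1.
  have := Mhw i isT; rewrite -memvE memv_cap => /andP[_].
  rewrite memv_ker add_lfunE opp_lfunE scale_lfunE id_lfunE subr_eq0 => /eqP/matrixP/(_ a p1).
  rewrite !mxE lfunE /= tr_diag_mx mul_mx_diag mul_diag_mx !mxE => <-.
  rewrite expfzDr // mulrAC; congr (q ^ _ * _ * q ^ _).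
    by elim/ord2_ind: i; elim/ord7_ind: (a).
  by elim/ord2_ind: i.
move=> ak; apply/eqP; apply: contraNT ak => Ma.
have {}KM i := q_expz_inj (mulIf Ma (KM i)).
move: (KM i1) (KM i2); clear -k4.
by case: k k4 => [|[|[|[|//]]]] _; elim/ord7_ind: a.
Qed.

Lemma highest_weight_line k M : (k < 4)%N ->
  M \in highest_weight_space q (nth 0 VV_weights k) -> M \in <[hw k]>%VS.
Proof.
move=> k4 Mhw.
(* The vectors of [shw] are normalised to have coefficient 1 at the only admissible entry of the
   column of v_1. Subtracting [M a p1] times [hw k] therefore clears that column. *)
have : hw k (nth p1 [:: p1; p2; z0; n1] k) p1 = 1.
  rewrite /hw /ev summxE; case: k k4 {Mhw} => [|[|[|[|//]]]] _;
    by rewrite !big_cons big_nil !mxE /= ?(mulr0, addr0, add0r, mulr1) lev_mon mul1r.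
set a := nth p1 _ k => hw1.
suff /eqP : M - M a p1 *: hw k = 0 by rewrite subr_eq0 => /eqP ->; rewrite memvZ ?memv_line.
have Nhw : M - M a p1 *: hw k \in highest_weight_space q (nth 0 VV_weights k).
  by rewrite memvB // memvZ // hw_mem.
apply: hw_column1_eq0 => [i|].
  move: Nhw; rewrite memvE => /subv_bigcapP/(_ i isT); rewrite -memvE memv_cap => /andP[].
  by rewrite memv_ker => /eqP.
apply/matrixP => b z; rewrite ord1 -colE mxE [RHS]mxE.
have [->|ba] := eqVneq b a; last exact: hw_entry_eq0 k4 Nhw ba.
by rewrite !mxE hw1 mulr1 subrr.
Qed.

Definition Rmu (mu : weight) : K := Reigen (index mu VV_weights).

(** The eigenspace [E] of [Rop] contains the highest weight line and is stable under every
    generator, as [Rop] commutes with the action. By induction it contains every stage of the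
    generated submodule. *)
Lemma Vcomp_eigen mu : mu \in VV_weights ->
  forall M, M \in Vcomp q mu -> Rop M = Rmu mu *: M.
Proof.
move=> mu_w M; set E := lker (Rop - Rmu mu *: \1%VF).
have memE N : (N \in E) = (Rop N == Rmu mu *: N).
  by rewrite memv_ker add_lfunE opp_lfunE scale_lfunE id_lfunE subr_eq0.
suff /subvP sub : (Vcomp q mu <= E)%VS by move/sub; rewrite memE => /eqP.
have k4 : (index mu VV_weights < 4)%N by rewrite index_mem.
rewrite /Vcomp /submodule_generated; elim: (\dim _) => [|n IHn] /=.
  apply/subvP=> N; rewrite -{1}(nth_index 0 mu_w) => /(highest_weight_line k4).
  case/vlineP=> c ->; rewrite memE linearZ /= Rop_hw // !scalerA mulrC.
  exact/eqP.
rewrite subv_add IHn /=; apply: (big_ind (fun U => (U <= E)%VS)) => [|U W|g _].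
- exact: sub0v.
- by rewrite subv_add => -> ->.
apply/subvP=> N /memv_imgP[N' /(subvP IHn)]; rewrite !memE => /eqP RN' ->.
by rewrite Rop_actVV RN' linearZ.
Qed.

(** The iteration defining [Vcomp] has become stationary, so one further round, which adds the
    images under all generators, stays inside. *)
Lemma Vcomp_actF mu i M : M \in Vcomp q mu -> actVV q (gF i) M \in Vcomp q mu.
Proof.
rewrite {2}/Vcomp /submodule_generated -iter_vspace_stationary => [|W]; last exact: addvSl.
rewrite -[iter _ _ _]/(Vcomp q mu) => VM; move/(memv_img (actVV q (gF i))): VM.
apply: subvP; rewrite /Uq_gens !big_cat !big_map -!enumT !big_enum /=.
apply: subv_trans (addvSr _ _); apply: subv_trans (addvSr _ _).
by apply: subv_trans (addvSl _ _); apply: (sumv_sup i).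
Qed.

Definition VVsum : {vspace 'M[K]_7} := (\sum_(mu <- VV_weights) Vcomp q mu)%VS.

Lemma VVsum_actF i M : M \in VVsum -> actVV q (gF i) M \in VVsum.
Proof.
rewrite /VVsum; elim: VV_weights M => [|mu s IHs] M.
  by rewrite big_nil !memv0 => /eqP->; rewrite linear0.
rewrite big_cons => /memv_addP[N VN [N' sN' ->]].
by rewrite linearD memv_add ?IHs //= Vcomp_actF.
Qed.

Lemma VVsum_hw k : (k < 4)%N -> hw k \in VVsum.
Proof.
move=> k4; rewrite /VVsum (big_nth 0) big_mkord memvE.
apply: (sumv_sup (Ordinal k4)) => //; rewrite -memvE /= /Vcomp /submodule_generated.
elim: (\dim _) => [|n IHn] /=; first exact: hw_mem.
by apply: subvP IHn; apply: addvSl.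
Qed.

(* Unification would unfold the 49-fold iteration. *)
Local Opaque Vcomp.

(** Soundness of the certificate: each step writes [d] times a new basis tensor as a combination of
    elements of [VVsum], and [d] is invertible. The sum is stable under the F_i and contains the
    highest weight vectors. *)
Lemma spans_from_full known steps :
    spans_from known steps -> {in known, forall ab, unit2 K ab \in VVsum} ->
  forall ab, unit2 K ab \in VVsum.
Proof.
elim: steps known => [|[[ab d] s] steps IHsteps] known.
  rewrite /spans_from => /allP all_known known_in [a b]; apply/known_in/all_known.
  by elim/ord7_ind: a; elim/ord7_ind: b.
rewrite /=; case/and4P=> s_ok /eqP val_s d0 steps_ok known_in.
apply: IHsteps steps_ok _ => cd; rewrite inE => /predU1P[->|/known_in //].
have -> : unit2 K ab = (lev q d)^-1 *: ev q (unit2 K) (sbind cmp2 s source_val).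
  by rewrite val_s ev_cons ev_nil addr0 scalerA mulVf ?scale1r ?lev_neq0.
apply: memvZ; rewrite ev_sbind //; elim: s s_ok {val_s} => [|[p src] s IHs] /=.
  by rewrite ev_nil mem0v.
case/andP=> src_ok /IHs s_in; rewrite ev_cons memvD // memvZ //.
case: src src_ok {IHs s_in} => [i a b|a b|k] src_ok; last exact: VVsum_hw.
  by rewrite -[source_val _]/(sactVV (gF i) (a, b)) -actVV_unit2 // VVsum_actF // known_in.
by rewrite ev_sunit known_in.
Qed.

Lemma VVsum_full : VVsum = fullv.
Proof.
apply/eqP; rewrite eqEsubv subvf; apply/subvP=> M _.
rewrite (matrix_sum_delta M); apply: memv_suml => a _; apply: memv_suml => b _.
by apply/memvZ/(spans_from_full spanning_steps_ok _ (a, b)).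
Qed.

(** Squaring removes the signs and leaves q^4, 1, q^-12, q^-24, which are pure powers with distinct
    exponents. *)
Lemma Rmu_inj : {in VV_weights &, injective Rmu}.
Proof.
pose e mu : int := nth 0 [:: 4; 0; -12; -24] (index mu VV_weights).
have Rsq mu : mu \in VV_weights -> Rmu mu ^+ 2 = q ^ e mu.
  rewrite /e /Rmu /Reigen -index_mem.
  case: index => [|[|[|[|//]]]] _; rewrite lev_mon /Zval /Zpow /= ?mul1r ?mulN1r ?sqrrN;
    by rewrite exprnP exprz_exp.
move=> mu nu mu_w nu_w /(congr1 (fun c => c ^+ 2)); rewrite !Rsq // => /q_expz_inj.
by move: mu_w nu_w; rewrite !inE => /or4P[]/eqP-> /or4P[]/eqP->.
Qed.

(** The projection [daddv_pi] behaves as expected once its two subspaces meet trivially. They do,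
    because [Rop] has eigenvalue [Rmu mu] on the first and different eigenvalues on the summands of
    the second. *)
Lemma proj_Vcomp mu nu M : mu \in VV_weights -> nu \in VV_weights ->
  M \in Vcomp q nu -> proj q mu M = if nu == mu then M else 0.
Proof.
move=> mu_w nu_w VM; have cap0 : (Vcomp q mu :&:
    \sum_(nu <- VV_weights | nu != mu) Vcomp q nu = 0)%VS.
  apply/eqP; rewrite -subv0; apply/subvP=> N; rewrite memv_cap memv0 => /andP[VN sN].
  apply/eqP; apply: (sumv_eigen_eq0 Vcomp_eigen) sN; last exact: Vcomp_eigen VN.
  by move=> la la_w; apply: contraNneq => /(Rmu_inj la_w mu_w)->.
rewrite /proj; set W := (\sum_(nu <- VV_weights | nu != mu) _)%VS in cap0 *.
have [eq_nu|neq_nu] := eqVneq nu mu.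
  by rewrite eq_nu in VM; apply: daddv_pi_id cap0 VM.
(* For nu different from mu, [M] lies in the complement [W]. The projections to the two subspaces
   add up to [M], and the one to [W] already returns [M]. *)
have sM : M \in W by rewrite /W (big_rem nu) //= neq_nu -[M]addr0 memv_add ?mem0v.
have := daddv_pi_add cap0 (subvP (addvSr _ _) M sM).
by rewrite [daddv_pi W _ M](daddv_pi_id _ sM) 1?capvC // -[RHS]add0r => /addIr.
Qed.

(** Here [P] stands for the projections: all that matters is that exactly one of them keeps [M] and
    the others kill it. *)
Lemma Rmu_comb (P : weight -> 'End('M[K]_7)) mu M : mu \in VV_weights ->
    (forall la, la \in VV_weights -> P la M = if mu == la then M else 0) ->
  (q ^+ 2 *: P (lambda1 *+ 2) + q ^- 12 *: P 0 - P lambda2 - q ^- 6 *: P lambda1) M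
    = Rmu mu *: M.
Proof.
move=> mu_w PM; rewrite !(add_lfunE, opp_lfunE, scale_lfunE).
rewrite (PM (lambda1 *+ 2) isT) (PM 0 isT) (PM lambda2 isT) (PM lambda1 isT).
move: mu_w; rewrite !inE.
by case/or4P=> /eqP-> /=; rewrite ?(scaler0, addr0, oppr0, add0r, subr0, sub0r);
  rewrite /Rmu /Reigen lev_mon /Zval /Zpow /= ?mul1r ?mulN1r ?mulr1 ?scaleN1r ?scaleNr.
Qed.

Lemma RVV_unit2 ab : RVV q (unit2 K ab) = ev q (unit2 K) (sRVV ab).
Proof.
rewrite -Rop_unit2; have: unit2 K ab \in VVsum by rewrite VVsum_full memvf.
move: (unit2 K ab); rewrite /VVsum.
(* Both operators are linear, so they are compared one summand at a time. The inclusion records,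
   through the induction on the list of summands, that each weight is one of the four. *)
have: {subset VV_weights <= VV_weights} by [].
elim: {1 3}VV_weights => [|mu s IHs] sub M.
  by rewrite big_nil memv0 => /eqP->; rewrite !linear0.
have mu_w := sub mu (mem_head _ _).
rewrite big_cons => /memv_addP[N VN [N' sN' ->]]; rewrite !linearD /=; congr (_ + _); last first.
  by apply: IHs => // la las; rewrite sub // mem_behead.
rewrite (Vcomp_eigen mu_w VN); apply: (Rmu_comb mu_w) => la la_w.
exact: proj_Vcomp.
Qed.
End Braiding.

(** * The invariant tensors as sparse combinations *)

Local Open Scope Z_scope.
Definition sphi : sparse pairs :=
  [:: (mon 1 4, (p1, n1)); (mon 1 (-6), (n1, p1)); (mon 1 3, (p2, n2));
      (mon 1 (-5), (n2, p2)); (mon 1 0, (p3, n3)); (mon 1 (-2), (n3, p3));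
      (mon 1 0, (z0, z0))].

(** The operators F_1, F_2, F_1, F_1, F_2, F_1 lead from v_1 through the basis in order, up to sign.
    The factor [c] of [next] compensates the sign, which is -1 for the last three. *)
Definition sgamma_list : seq (sparse pairs) :=
  let next c i x := sscale (mon c 0) (sbind cmp2 x (sactVV (gF i))) in
  let g1 := [:: (mon 1 0, (p1, z0)); ([:: (-1, -3); (-1, -1)], (p2, p3));
                ([:: (1, -6); (1, -4)], (p3, p2)); (mon (-1) (-6), (z0, p1))] in
  let g2 := next 1 i1 g1 in
  let g3 := next 1 i2 g2 in
  let g0 := next 1 i1 g3 in
  let g3' := next (-1) i1 g0 in
  let g2' := next (-1) i2 g3' in
  let g1' := next (-1) i1 g2' in
  [:: g1; g2; g3; g0; g3'; g2'; g1'].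
Definition sgamma (a : 'I_7) : sparse pairs := nth [::] sgamma_list a.

Definition cmp3 : keyCmp ('I_7 * 'I_7 * 'I_7) := cmp_pair cmp2 (cmp_ord 7).
Definition cmp5 : keyCmp ('I_7 * 'I_7 * 'I_7 * 'I_7 * 'I_7) :=
  cmp_pair (cmp_pair cmp3 (cmp_ord 7)) (cmp_ord 7).

Definition spsi : sparse ('I_7 * 'I_7 * 'I_7) :=
  sbind cmp3 sphi (fun rc => sbind cmp3 (sgamma rc.2) (fun st =>
    [:: (mon (-1) 3, (rc.1, st.1, st.2))])).

Definition stheta : sparse ('I_7 * 'I_7 * 'I_7 * 'I_7 * 'I_7) :=
  sbind cmp5 spsi (fun ast =>
  sbind cmp5 (sgamma ast.1.2) (fun bc =>
  sbind cmp5 (sgamma ast.2) (fun de =>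
    [:: (mon 1 6, (ast.1.1, bc.1, bc.2, de.1, de.2))]))).
Local Close Scope Z_scope.

(** * The multiplication of T(V)^{(x) m} *)

Definition cmp_word : keyCmp word := cmp_seq (cmp_ord 7).
Definition cmp_words : keyCmp (seq word) := cmp_seq cmp_word.

(** From here to [sbmul], the operations of the statement are copied in computable form, with
    [sbind] in place of [linext] and the table [sRVV] in place of [RVV]. *)
Fixpoint sbraid_letter (a : 'I_7) (w : word) : sparse (word * 'I_7) :=
  if w is b :: w' then
    sbind (cmp_pair cmp_word (cmp_ord 7)) (sRVV (a, b)) (fun ba =>
    sbind (cmp_pair cmp_word (cmp_ord 7)) (sbraid_letter ba.2 w') (fun p =>
      sunit (ba.1 :: p.1, p.2)))
  else sunit ([::], a).

Fixpoint sbraid_word (u w : word) : sparse (word * word) :=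
  if u is a :: u' then
    sbind (cmp_pair cmp_word cmp_word) (sbraid_word u' w) (fun p =>
    sbind (cmp_pair cmp_word cmp_word) (sbraid_letter a p.1) (fun p' =>
      sunit (p'.1, p'.2 :: p.2)))
  else sunit (w, [::]).

Fixpoint sbraid_words (us : seq word) (w : word) : sparse (word * seq word) :=
  if us is u :: us' then
    sbind (cmp_pair cmp_word cmp_words) (sbraid_words us' w) (fun p =>
    sbind (cmp_pair cmp_word cmp_words) (sbraid_word u p.1) (fun p' =>
      sunit (p'.1, p'.2 :: p.2)))
  else sunit (w, [::]).

Fixpoint sbmul_words (us ws : seq word) : sparse (seq word) :=
  match us, ws with
  | u :: us', w :: ws' =>
    sbind cmp_words (sbraid_words us' w) (fun p =>
    sbind cmp_words (sbmul_words p.2 ws') (fun vs =>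
      sunit ((u ++ p.1) :: vs)))
  | _, _ => sunit [::]
  end.

Definition sbmul (x y : sparse (seq word)) : sparse (seq word) :=
  sbind cmp_words x (fun us => sbind cmp_words y (sbmul_words us)).

(** * Agreement of the sparse computation with the free modules *)

Section Linext.
Variable (K : fieldType).

Section Linear.
Variables (T T' : choiceType) (f : T -> {malg K[T']}).

(** Summing over a larger set than the support gives [x], [y] and [c *: x + y] a common index set in
    the proof of linearity. *)
Lemma linextEw (d : {fset T}) (x : {malg K[T]}) : (msupp x `<=` d)%fset ->
  linext f x = \sum_(k <- d) x@_k *: f k.
Proof.
move=> le_xd; rewrite /linext (big_fset_incl _ le_xd) // => k _ /mcoeff_outdom ->.
by rewrite scale0r.
Qed.

Lemma linext_is_linear : linear (linext f).
Proof.
move=> c x y; pose d := (msupp x `|` msupp y)%fset.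
have dx : (msupp x `<=` d)%fset by exact: fsubsetUl.
have dy : (msupp y `<=` d)%fset by exact: fsubsetUr.
have dxy : (msupp (c *: x + y) `<=` d)%fset.
  apply: fsubset_trans (msuppD_le _ _) _; apply: fsetUSS => //.
  exact: msuppZ_le.
rewrite (linextEw dx) (linextEw dy) (linextEw dxy) scaler_sumr -big_split.
by apply: eq_bigr => k _ /=; rewrite mcoeffD mcoeffZ scalerDl scalerA.
Qed.
HB.instance Definition _ :=
  GRing.isLinear.Build K {malg K[T]} {malg K[T']} _ (linext f) linext_is_linear.

Lemma linextU k : linext f << k >> = f k.
Proof.
rewrite (linextEw (d := [fset k]%fset)) ?msuppU_le // big_seq_fset1.
by rewrite mcoeffUU scale1r.
Qed.
End Linear.

Lemma eq_linext (T T' : choiceType) (f g : T -> {malg K[T']}) :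
  f =1 g -> linext f =1 linext g.
Proof. by move=> fg x; apply: eq_bigr => k _; rewrite fg. Qed.
End Linext.

Section Mirror.
Variables (K : fieldType) (q : K).
Hypothesis q_transc : forall p : {poly int}, p != 0 -> (map_poly intr p).[q] != 0.
Let q0 : q != 0 := q_neq0 q_transc.

Definition mev (T : choiceType) (x : sparse T) : {malg K[T]} :=
  ev q (fun k => << k >>) x.

Lemma mev_sunit (T : choiceType) (k : T) : mev (sunit k) = << k >>.
Proof. exact: ev_sunit. Qed.

Lemma mev_sbind (T : Type) (U : choiceType) (cmp : keyCmp U) x (f : T -> sparse U) :
  mev (sbind cmp x f) = ev q (fun k => mev (f k)) x.
Proof. exact: ev_sbind. Qed.

Lemma linext_mev (T U : choiceType) (f : T -> {malg K[U]}) (x : sparse T) :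
  linext f (mev x) = ev q f x.
Proof. by rewrite linear_ev; apply: eq_ev => k; apply: linextU. Qed.

Lemma braid_letterE a w : braid_letter q a w = mev (sbraid_letter a w).
Proof.
elim: w a => [|b w IHw] a; first by rewrite mev_sunit.
rewrite [LHS]/= mev_sbind.
pose G ba := linext (fun p => << (ba.1 :: p.1, p.2) >>) (braid_letter q ba.2 w)
  : {malg K[(word * 'I_7)%type]}.
(* The double sum is the linear extension of [G] evaluated at the braiding of v_a (x) v_b, which
   [RVV_unit2] replaces by its table entry. *)
rewrite -[delta_mx a b]/(unit2 K (a, b)) -[LHS]/(lext G (RVV q (unit2 K (a, b)))).
rewrite (RVV_unit2 q_transc) linear_ev; apply: eq_ev => ba /=.
rewrite lext_unit2 /G IHw linext_mev mev_sbind.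
by apply: eq_ev => p; rewrite mev_sunit.
Qed.

Lemma braid_wordE u w : braid_word q u w = mev (sbraid_word u w).
Proof.
elim: u => [|a u IHu] /=; first by rewrite mev_sunit.
rewrite IHu linext_mev mev_sbind; apply: eq_ev => p.
rewrite braid_letterE linext_mev mev_sbind; apply: eq_ev => p'.
by rewrite mev_sunit.
Qed.

Lemma braid_wordsE us w : braid_words q us w = mev (sbraid_words us w).
Proof.
elim: us => [|u us IHus] /=; first by rewrite mev_sunit.
rewrite IHus linext_mev mev_sbind; apply: eq_ev => p.
rewrite braid_wordE linext_mev mev_sbind; apply: eq_ev => p'.
by rewrite mev_sunit.
Qed.

Lemma bmul_wordsE us ws : bmul_words q us ws = mev (sbmul_words us ws).
Proof.
elim: ws us => [|w ws IHws] [|u us]; rewrite ?mev_sunit //=.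
rewrite braid_wordsE linext_mev mev_sbind; apply: eq_ev => p.
rewrite IHws linext_mev mev_sbind; apply: eq_ev => vs.
by rewrite mev_sunit.
Qed.

Lemma bmulE x y : bmul q (mev x) (mev y) = mev (sbmul x y).
Proof.
rewrite /bmul linext_mev mev_sbind; apply: eq_ev => us.
by rewrite linext_mev mev_sbind; apply: eq_ev => ws; apply: bmul_wordsE.
Qed.

Lemma lext_ev (L : lmodType K) (G : pairs -> L) x :
  lext G (ev q (unit2 K) x) = ev q G x.
Proof. by rewrite linear_ev; apply: eq_ev => ab; apply: lext_unit2. Qed.

Lemma phiE : phi q = ev q (unit2 K) sphi.
Proof.
rewrite /ev !big_cons big_nil !lev_mon /Zval /Zpow /= !mul1r !scale1r addr0 !addrA.
by [].
Qed.

Section Gamma.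
Variable gamma : 'Hom('cV[K]_7, 'M[K]_7).
Hypothesis gammaP : is_gamma q gamma.

Lemma gamma_vb a : gamma (vb a) = ev q (unit2 K) (sgamma a).
Proof.
have [gammaV gamma1] := gammaP.
(* If F_i v_b = d v_c with d^2 = 1, equivariance gives gamma(v_c) = d F_i gamma(v_b). *)
have step i b c (x : sparse pairs) d : Zval K d * Zval K d = 1 ->
    actF i *m vb b = Zval K d *: vb c -> gamma (vb b) = ev q (unit2 K) x ->
  gamma (vb c) = ev q (unit2 K) (sscale (mon d 0) (sbind cmp2 x (sactVV (gF i)))).
  move=> dd Fb gb; rewrite ev_sscale // lev_mon mulr1 -(actVV_ev q_transc) -gb -gammaV.
  by rewrite [actV _ _]/= Fb linearZ /= scalerA dd scale1r.
have one : Zval K 1 * Zval K 1 = 1 by rewrite mulr1.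
have mone : Zval K (-1) * Zval K (-1) = 1 by rewrite -rmorphM.
have F1 := actF_vb q i1; have F2 := actF_vb q i2.
have g1 : gamma (vb p1) = ev q (unit2 K) (sgamma p1).
  rewrite gamma1 /ev !big_cons big_nil !lev_mon /lev !big_cons !big_nil /Zval /Zpow /=.
  rewrite /unit2 ?(mul1r, mulN1r, addr0, scale1r) -opprD !scaleNr -!addrA; congr (_ + _).
  (* This is the coefficient of v_3 (x) v_2 once the product in gamma(v_1) is expanded. *)
  have -> : q ^ (-6) + q ^ (-4) = (q ^- 3 + q^-1) * q ^- 3.
    by rewrite mulrDl -!invfM -exprD -exprS.
  by rewrite scalerBr scalerA opprB addrC -addrA addrCA.
have g2 : gamma (vb p2) = ev q (unit2 K) (sgamma p2).
  by apply: step one _ g1; rewrite F1 ev_cons ev_nil lev_mon mulr1 addr0.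
have g3 : gamma (vb p3) = ev q (unit2 K) (sgamma p3).
  by apply: step one _ g2; rewrite F2 ev_cons ev_nil lev_mon mulr1 addr0.
have g0 : gamma (vb z0) = ev q (unit2 K) (sgamma z0).
  by apply: step one _ g3; rewrite F1 ev_cons ev_nil lev_mon mulr1 addr0.
have g3' : gamma (vb n3) = ev q (unit2 K) (sgamma n3).
  by apply: step mone _ g0; rewrite F1 ev_cons ev_nil lev_mon mulr1 addr0.
have g2' : gamma (vb n2) = ev q (unit2 K) (sgamma n2).
  by apply: step mone _ g3'; rewrite F2 ev_cons ev_nil lev_mon mulr1 addr0.
have g1' : gamma (vb n1) = ev q (unit2 K) (sgamma n1).
  by apply: step mone _ g2'; rewrite F1 ev_cons ev_nil lev_mon mulr1 addr0.
by elim/ord7_ind: a.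
Qed.

(** The target [L] is arbitrary because [G] takes two forms: products of generators for the element
    [Psi], and nested extensions along gamma inside [theta_sum]. *)
Lemma psi_sum (L : lmodType K) (G : 'I_7 -> 'I_7 -> 'I_7 -> L) :
  \sum_r \sum_s \sum_t psi q gamma r s t *: G r s t =
  ev q (fun rst => G rst.1.1 rst.1.2 rst.2) spsi.
Proof.
transitivity (lext (fun rc => - q ^+ 3 *:
    lext (fun st => G rc.1 st.1 st.2) (gamma (vb rc.2))) (phi q)).
  apply: eq_bigr => r _; rewrite /lext /=.
  under [RHS]eq_bigr do rewrite scalerA scaler_sumr.
  rewrite [RHS]exchange_big; apply: eq_bigr => s _.
  under [RHS]eq_bigr do rewrite scaler_sumr.
  rewrite [RHS]exchange_big; apply: eq_bigr => t _.
  rewrite /psi mulr_sumr scaler_suml; apply: eq_bigr => c _.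
  by rewrite scalerA mulrCA mulrA.
rewrite phiE lext_ev [RHS]ev_sbind //; apply: eq_ev => rc.
rewrite gamma_vb lext_ev [RHS]ev_sbind // scaler_ev; apply: eq_ev => st.
by rewrite ev_cons ev_nil addr0 lev_mon mulN1r.
Qed.

Lemma theta_sum (L : lmodType K) (G : 'I_7 -> 'I_7 -> 'I_7 -> 'I_7 -> 'I_7 -> L) :
  \sum_a \sum_b \sum_c \sum_d \sum_e theta q gamma a b c d e *: G a b c d e =
  ev q (fun '(a, b, c, d, e) => G a b c d e) stheta.
Proof.
have exch (F : 'I_7 -> 'I_7 -> 'I_7 -> L) :
    \sum_s \sum_t \sum_b F s t b = \sum_b \sum_s \sum_t F s t b.
  by under eq_bigr do rewrite exchange_big; apply: exchange_big.
(* The sums over the inner indices [s] and [t] of [theta] are moved outside those over [b], [c],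
   [d], [e]. The latter then become extensions along gamma(v_s) and gamma(v_t). *)
transitivity (\sum_a \sum_s \sum_t psi q gamma a s t *: (q ^+ 6 *:
    lext (fun bc => lext (fun de => G a bc.1 bc.2 de.1 de.2) (gamma (vb t))) (gamma (vb s)))).
  apply: eq_bigr => a _; rewrite /lext /=.
  under [RHS]eq_bigr do under eq_bigr do rewrite scalerA scaler_sumr.
  rewrite [RHS]exch; apply: eq_bigr => b _.
  under [RHS]eq_bigr do under eq_bigr do rewrite scaler_sumr.
  rewrite [RHS]exch; apply: eq_bigr => c _.
  under [RHS]eq_bigr do under eq_bigr do rewrite scalerA scaler_sumr.
  rewrite [RHS]exch; apply: eq_bigr => d _.
  under [RHS]eq_bigr do under eq_bigr do rewrite scaler_sumr.
  rewrite [RHS]exch; apply: eq_bigr => e _.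
  rewrite /theta mulr_sumr scaler_suml; apply: eq_bigr => s _.
  rewrite mulr_sumr scaler_suml; apply: eq_bigr => t _.
  rewrite scalerA; move: (psi q gamma a s t) (q ^+ 6) => p q6.
  by rewrite !mulrA (mulrC p).
rewrite (psi_sum (fun a s t => q ^+ 6 *: lext (fun bc => lext (fun de =>
  G a bc.1 bc.2 de.1 de.2) (gamma (vb t))) (gamma (vb s)))).
rewrite [RHS]ev_sbind //; apply: eq_ev => ast.
rewrite !gamma_vb lext_ev [RHS]ev_sbind // scaler_ev; apply: eq_ev => bc.
rewrite lext_ev [RHS]ev_sbind // scaler_ev; apply: eq_ev => de.
by rewrite ev_cons ev_nil addr0 lev_mon mul1r.
Qed.
End Gamma.
End Mirror.

(** * The identity in five slots *)

Section Products.
Variable m : nat.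
Implicit Types i j k r s t : 'I_m.

Definition sX i (a : 'I_7) : sparse (seq word) :=
  sunit (mkseq (fun l : nat => if l == i then [:: a] else [::]) m).

Definition sPhi i j : sparse (seq word) :=
  sbind cmp_words sphi (fun ab => sbmul (sX i ab.1) (sX j ab.2)).

Definition sPsi i j k : sparse (seq word) :=
  sbind cmp_words spsi (fun rst =>
    sbmul (sbmul (sX i rst.1.1) (sX j rst.1.2)) (sX k rst.2)).

Definition sTheta i j r s t : sparse (seq word) :=
  sbind cmp_words stheta (fun '(a, b, c, d, e) =>
    sbmul (sbmul (sbmul (sbmul (sX i a) (sX j b)) (sX r c)) (sX s d)) (sX t e)).
End Products.

Definition slot0 : 'I_5 := @Ordinal 5 0 isT.
Definition slot1 : 'I_5 := @Ordinal 5 1 isT.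
Definition slot2 : 'I_5 := @Ordinal 5 2 isT.
Definition slot3 : 'I_5 := @Ordinal 5 3 isT.
Definition slot4 : 'I_5 := @Ordinal 5 4 isT.

Local Open Scope Z_scope.
(** This is the computational core: both sides evaluate to the same normal form with coefficients in
    Z[q, q^-1]. The minus signs of the identity sit in the coefficients: the two-term lists stand
    for -(q - q^-1) and -(q^2 + q^-2). *)
Lemma five_slots_sparse :
  sscale (mon 1 1) (sbmul (sPsi slot1 slot3 slot4) (sPhi slot0 slot2)) =
  sadd cmp_words
    (sadd cmp_words
      (sscale (mon 1 (-1)) (sbmul (sPhi slot0 slot2) (sPsi slot1 slot3 slot4)))
      (sscale [:: (1, -1); (-1, 1)]
        (sbmul (sPhi slot0 slot1) (sPsi slot2 slot3 slot4))))
    (sscale [:: (1, -1); (-1, 1)]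
      (sadd cmp_words
        (sscale [:: (-1, -2); (-1, 2)]
          (sbmul (sPhi slot1 slot2) (sPsi slot0 slot3 slot4)))
        (sTheta slot0 slot1 slot2 slot3 slot4))).
Proof. by vm_compute. Qed.
Local Close Scope Z_scope.

Section FiveSlots.
Variables (K : fieldType) (q : K).
Hypothesis q_transc : forall p : {poly int}, p != 0 -> (map_poly intr p).[q] != 0.
Let q0 : q != 0 := q_neq0 q_transc.
Variable gamma : 'Hom('cV[K]_7, 'M[K]_7).
Hypothesis gammaP : is_gamma q gamma.
Local Notation mev := (mev q).

Section Mirror.
Variable m : nat.
Implicit Types i j k r s t : 'I_m.

Lemma XE i a : X i a = mev (sX i a).
Proof. by rewrite mev_sunit. Qed.

Lemma PhiE i j : Phi q i j = mev (sPhi i j).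
Proof.
rewrite -[Phi q i j]/(lext (fun ab => bmul q (X i ab.1) (X j ab.2)) (phi q)).
rewrite phiE lext_ev [RHS]mev_sbind; [|exact: q_transc]; apply: eq_ev => ab.
by rewrite !XE bmulE.
Qed.

Lemma PsiE i j k : Psi q gamma i j k = mev (sPsi i j k).
Proof.
rewrite /Psi (psi_sum q_transc gammaP (fun a b c =>
  bmul q (bmul q (X i a) (X j b)) (X k c))) [RHS]mev_sbind; [|exact: q_transc].
apply: eq_ev => abc.
by rewrite !XE !bmulE.
Qed.

Lemma ThetaE i j r s t : Theta q gamma i j r s t = mev (sTheta i j r s t).
Proof.
rewrite /Theta (theta_sum q_transc gammaP (fun a b c d e =>
  bmul q (bmul q (bmul q (bmul q (X i a) (X j b)) (X r c)) (X s d)) (X t e))).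
rewrite [RHS]mev_sbind; [|exact: q_transc]; apply: eq_ev => -[[[[a b] c] d] e].
by rewrite !XE !bmulE.
Qed.
End Mirror.

Lemma five_slots :
  q *: bmul q (Psi q gamma slot1 slot3 slot4) (Phi q slot0 slot2) =
  q^-1 *: bmul q (Phi q slot0 slot2) (Psi q gamma slot1 slot3 slot4)
  - (q - q^-1) *: bmul q (Phi q slot0 slot1) (Psi q gamma slot2 slot3 slot4)
  - (q - q^-1) *:
      (- ((q ^+ 2 + q ^- 2) *:
           bmul q (Phi q slot1 slot2) (Psi q gamma slot0 slot3 slot4))
       + Theta q gamma slot0 slot1 slot2 slot3 slot4).
Proof.
have lev2 (a b c d : Z) : lev q [:: (a, b); (c, d)] = Zval K a * Zpow q b + Zval K c * Zpow q d.
  by rewrite /lev !big_cons big_nil addr0.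
(* The five products are replaced by variables, so that passing to [K] rewrites the coefficients
   without evaluating the products. *)
have mev_eq (A B C D T : sparse (seq word)) :
    sscale (mon 1 1) A =
    sadd cmp_words
      (sadd cmp_words (sscale (mon 1 (-1)) B) (sscale [:: (Zpos 1, Zneg 1); (Zneg 1, Zpos 1)] C))
      (sscale [:: (Zpos 1, Zneg 1); (Zneg 1, Zpos 1)]
        (sadd cmp_words (sscale [:: (Zneg 1, Zneg 2); (Zneg 1, Zpos 2)] D) T)) ->
  q *: mev A = q^-1 *: mev B - (q - q^-1) *: mev C
    - (q - q^-1) *: (- ((q ^+ 2 + q ^- 2) *: mev D) + mev T).
  move/(congr1 (fun x => mev x)).
  rewrite /mev !(ev_sadd, ev_sscale) // !lev_mon !lev2 /Zval /Zpow /= !mul1r !mulN1r => ->.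
  by rewrite -[q ^ (-1) - _]opprB !scaleNr -opprD scaleNr [q ^ (-2) + _]addrC.
rewrite !PhiE !PsiE ThetaE !bmulE; [exact: mev_eq five_slots_sparse|exact: q_transc..].
Qed.

End FiveSlots.

(** * Inserting empty slots *)

(* The clauses for lists of the wrong size make bmul_words_expand hold without
   any hypothesis on sizes. *)
Fixpoint expand (mask : bitseq) (us : seq word) : seq word :=
  match mask, us with
  | [::], _ => us
  | false :: mask', _ => [::] :: expand mask' us
  | true :: mask', u :: us' => u :: expand mask' us'
  | true :: _, [::] => [::]
  end.

(** The sequence underlying [X], with a natural number as index so that induction on the mask can
    shift it. *)
Definition letter_at (n k : nat) (a : 'I_7) : seq word :=
  mkseq (fun l => if l == k then [:: a] else [::]) n.

Lemma mkseqS (T : Type) (f : nat -> T) n :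
  mkseq f n.+1 = f 0%N :: mkseq (fun l => f l.+1) n.
Proof. by rewrite /mkseq /= (iotaDl 1 0 n) -map_comp. Qed.

Lemma expand_nseq mask :
  expand mask (nseq (count id mask) [::]) = nseq (size mask) [::].
Proof. by elim: mask => [|[] mask IHmask] //=; rewrite IHmask. Qed.

(** A selected slot [i] comes from the position that counts the selected slots before it. *)
Lemma expand_letter_at mask i a : nth false mask i ->
  expand mask (letter_at (count id mask) (count id (take i mask)) a) =
  letter_at (size mask) i a.
Proof.
have letter_at0 n : letter_at n.+1 0 a = [:: a] :: nseq n [::].
  rewrite /letter_at mkseqS; congr (_ :: _).
  by elim: n => //= n IHn; rewrite mkseqS /= IHn.
elim: mask i => [|b mask IHmask] [|i] //=.
  by case: b => // _; rewrite add1n !letter_at0 /= expand_nseq.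
move=> mask_i; rewrite [RHS]/letter_at mkseqS /= -[mkseq _ _]/(letter_at _ i a).
rewrite -IHmask //; case: b => //=.
by rewrite /letter_at /mkseq add0n (iotaDl 1 0) -map_comp.
Qed.

Section Expand.
Variables (K : fieldType) (q : K).

Lemma linext_id (T : choiceType) (x : {malg K[T]}) : linext (fun k => << k >>) x = x.
Proof.
rewrite [RHS]monalgE; apply: eq_bigr => k _; apply/malgP => l.
by rewrite mcoeffZ !mcoeffU mulrnAr mulr1.
Qed.

Lemma linext_comp (T U V : choiceType) (f : U -> {malg K[V]}) (g : T -> {malg K[U]}) x :
  linext f (linext g x) = linext (fun k => linext f (g k)) x.
Proof. by rewrite [linext g x]/linext linear_sum; apply: eq_bigr => k _; rewrite linearZ. Qed.

(** The braiding with the unit is the flip, so an empty slot of the right factor moves past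
    everything unchanged. *)
Lemma braid_word_nil u : braid_word q u [::] = << ([::], u) >>.
Proof. by elim: u => [|a u IHu] //=; rewrite IHu !linextU. Qed.

Lemma braid_words_nil us : braid_words q us [::] = << ([::], us) >>.
Proof. by elim: us => [|u us IHus] //=; rewrite IHus linextU braid_word_nil linextU. Qed.

(** An empty slot of the left factor lets [w] through unchanged, since [braid_word] with empty first
    word is the flip. *)
Lemma braid_words_expand mask us w :
  braid_words q (expand mask us) w =
  linext (fun p => << (p.1, expand mask p.2) >>) (braid_words q us w).
Proof.
elim: mask us => [|b mask IHmask] us.
  by rewrite -[LHS]linext_id; apply: eq_linext => -[].
case: b => [|] /=; last first.
  rewrite IHmask linext_comp; apply: eq_linext => p.
  by rewrite !linextU.
case: us => [|u us] /=; first by rewrite linextU.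
rewrite IHmask !linext_comp; apply: eq_linext => p.
by rewrite linextU linext_comp; apply: eq_linext => p'; rewrite linextU.
Qed.

Definition lexpand (mask : bitseq) : {malg K[seq word]} -> {malg K[seq word]} :=
  linext (fun us => << expand mask us >>).
HB.instance Definition _ mask := GRing.Linear.copy (lexpand mask)
  (linext (fun us => << expand mask us >>)).

Lemma bmul_words_expand mask us ws :
  bmul_words q (expand mask us) (expand mask ws) = lexpand mask (bmul_words q us ws).
Proof.
rewrite /lexpand; elim: mask us ws => [|b mask IHmask] us ws; first by rewrite linext_id.
case: b => [|] /=; last first.
  rewrite braid_words_nil linextU IHmask linext_comp; apply: eq_linext => vs.
  by rewrite linextU.
case: us ws => [|u us] [|w ws] /=; try by rewrite linextU.
rewrite braid_words_expand !linext_comp; apply: eq_linext => p.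
rewrite linextU IHmask !linext_comp; apply: eq_linext => vs.
by rewrite !linextU.
Qed.

(** Inserting unit slots is compatible with the braided product, which is what transports the
    five-slot identity to any [m]. *)
Lemma bmul_expand mask x y :
  bmul q (lexpand mask x) (lexpand mask y) = lexpand mask (bmul q x y).
Proof.
rewrite /bmul /lexpand !linext_comp; apply: eq_linext => us.
rewrite linextU !linext_comp; apply: eq_linext => ws.
by rewrite linextU bmul_words_expand.
Qed.

Section Slots.
Variables (m n : nat) (mask : bitseq) (f : 'I_n -> 'I_m).
Hypothesis Xf : forall k a, X (f k) a = lexpand mask (X k a).

Lemma Phi_expand i j : Phi q (f i) (f j) = lexpand mask (Phi q i j).
Proof.
rewrite linear_sum; apply: eq_bigr => a _; rewrite linear_sum; apply: eq_bigr => b _.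
by rewrite linearZ !Xf bmul_expand.
Qed.

Lemma Psi_expand gamma i j k :
  Psi q gamma (f i) (f j) (f k) = lexpand mask (Psi q gamma i j k).
Proof.
rewrite linear_sum; apply: eq_bigr => a _; rewrite linear_sum; apply: eq_bigr => b _.
rewrite linear_sum; apply: eq_bigr => c _.
by rewrite linearZ !Xf !bmul_expand.
Qed.

Lemma Theta_expand gamma i j r s t :
  Theta q gamma (f i) (f j) (f r) (f s) (f t) =
  lexpand mask (Theta q gamma i j r s t).
Proof.
rewrite linear_sum; apply: eq_bigr => a _; rewrite linear_sum; apply: eq_bigr => b _.
rewrite linear_sum; apply: eq_bigr => c _; rewrite linear_sum; apply: eq_bigr => d _.
rewrite linear_sum; apply: eq_bigr => e _.
by rewrite linearZ !Xf !bmul_expand.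
Qed.
End Slots.
End Expand.

Lemma count_mem_iota (s : seq nat) n :
  uniq s -> count (mem s) (iota 0 n) = count (fun x => x < n)%N s.
Proof.
move=> s_uniq; rewrite -!size_filter; apply/perm_size/uniq_perm.
- exact/filter_uniq/iota_uniq.
- exact: filter_uniq.
by move=> x; rewrite !mem_filter mem_iota /= andbC.
Qed.

Lemma X_expand (K : fieldType) (m : nat) (s : seq nat) (i : 'I_m) (k : 'I_(size s)) (a : 'I_7) :
    sorted ltn s -> all (fun x => x < m)%N s -> nth 0%N s k = i ->
  X i a = lexpand (mkseq (mem s) m) (X k a) :> @tpower K.
Proof.
move=> s_sorted s_m Dk; set mask := mkseq _ _.
have s_uniq : uniq s by rewrite (sorted_uniq ltn_trans ltnn).
have count_mask l : (l <= m)%N -> count id (take l mask) = count (fun x => x < l)%N s.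
  by move=> lm; rewrite /mask /mkseq -map_take take_iota (minn_idPl lm) count_map count_mem_iota.
have count_m : count id mask = size s.
  rewrite -[mask]take_size size_mkseq count_mask //.
  by apply/eqP; rewrite -all_count.
have count_i : count id (take i mask) = k.
  rewrite count_mask ?(ltnW (ltn_ord i)) // -Dk.
  (* In a strictly increasing list exactly [k] members lie below the one at position [k], counted
     from 0. *)
  by rewrite (@Order.PreorderTheory.count_lt_nth _ nat 0%N s k).
have mask_i : nth false mask i by rewrite nth_mkseq // -Dk; apply: mem_nth.
rewrite /lexpand linextU; congr << _ >>.
rewrite -[RHS]/(expand mask (letter_at _ k a)) -{1}count_m -count_i.
by rewrite expand_letter_at // size_mkseq.
Qed.

Lemma mul_Psi_Phi (K : fieldType) (q : K) (gamma : 'Hom('cV[K]_7, 'M[K]_7))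
    (m : nat) (i j r s t : 'I_m) :
    (forall p : {poly int}, p != 0 -> (map_poly intr p).[q] != 0) ->
    is_gamma q gamma -> (i < j)%N -> (j < r)%N -> (r < s)%N -> (s < t)%N ->
  q *: bmul q (Psi q gamma j s t) (Phi q i r) =
  q^-1 *: bmul q (Phi q i r) (Psi q gamma j s t)
  - (q - q^-1) *: bmul q (Phi q i j) (Psi q gamma r s t)
  - (q - q^-1) *:
      (- ((q ^+ 2 + q ^- 2) *: bmul q (Phi q j r) (Psi q gamma i s t))
       + Theta q gamma i j r s t).
Proof.
move=> q_transc gammaP ij jr rs st.
pose slots : seq nat := [:: val i; val j; val r; val s; val t].
pose f (k : 'I_5) : 'I_m := nth i [:: i; j; r; s; t] k.
have Xf k a : X (f k) a = lexpand (mkseq (mem slots) m) (X k a) :> @tpower K.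
  apply: (@X_expand _ _ slots) => [||].
  - by rewrite /= ij jr rs st.
  - by rewrite /= !ltn_ord.
  - by case: k => [[|[|[|[|[|//]]]]] ?].
pose F := lexpand (K := K) (mkseq (mem slots) m).
have FZ c x : F (c *: x) = c *: F x by exact: linearZ.
have FD x y : F (x + y) = F x + F y by exact: linearD.
have FN x : F (- x) = - F x by exact: linearN.
have FPsiPhi a b c d e : F (bmul q (Psi q gamma a b c) (Phi q d e)) =
    bmul q (Psi q gamma (f a) (f b) (f c)) (Phi q (f d) (f e)).
  by rewrite (Psi_expand q Xf) (Phi_expand q Xf) bmul_expand.
have FPhiPsi a b c d e : F (bmul q (Phi q a b) (Psi q gamma c d e)) =
    bmul q (Phi q (f a) (f b)) (Psi q gamma (f c) (f d) (f e)).
  by rewrite (Psi_expand q Xf) (Phi_expand q Xf) bmul_expand.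
have FTheta : F (Theta q gamma slot0 slot1 slot2 slot3 slot4) = Theta q gamma i j r s t.
  exact/esym/(Theta_expand q Xf gamma slot0 slot1 slot2 slot3 slot4).
(* From here on [F] is known only through linearity and its values on the five terms, so nothing
   below unfolds the expansion. *)
clearbody F.
have comb A B C D T A' B' C' D' T' :
    F A = A' -> F B = B' -> F C = C' -> F D = D' -> F T = T' ->
    q *: A = q^-1 *: B - (q - q^-1) *: C
             - (q - q^-1) *: (- ((q ^+ 2 + q ^- 2) *: D) + T) ->
    q *: A' = q^-1 *: B' - (q - q^-1) *: C'
              - (q - q^-1) *: (- ((q ^+ 2 + q ^- 2) *: D') + T').
  by move=> <- <- <- <- <- /(congr1 F); rewrite !(FD, FN, FZ).
exact: (comb _ _ _ _ _ _ _ _ _ _ (FPsiPhi slot1 slot3 slot4 slot0 slot2)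
  (FPhiPsi slot0 slot2 slot1 slot3 slot4) (FPhiPsi slot0 slot1 slot2 slot3 slot4)
  (FPhiPsi slot1 slot2 slot0 slot3 slot4) FTheta (five_slots q_transc gammaP)).
Qed.

(** Evaluating [p] at the indeterminate gives back [p] itself, with coefficients read in C and
    embedded into the fraction field. It stays nonzero because C has characteristic 0, so the
    leading coefficient survives. *)
Lemma indet_transc (R : realType) (p : {poly int}) :
  p != 0 -> (map_poly intr p).[indet R] != 0.
Proof.
move=> p0; pose pR : {poly R[i]} := map_poly intr p.
have -> : (map_poly intr p).[indet R] = tofrac pR.
  have -> : pR = (map_poly intr p).['X].
    rewrite -[LHS]comp_polyXr /comp_poly -map_poly_comp; congr _.[_].
    by apply: eq_map_poly => c /=; rewrite rmorph_int.
  rewrite -horner_map -map_poly_comp; congr _.[_].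
  by apply: eq_map_poly => c /=; rewrite rmorph_int.
by rewrite tofrac_eq0 map_poly_eq0_id0 // intr_eq0 lead_coef_eq0.
Qed.

Theorem lemma5p16 (R : realType) (gamma : 'Hom('cV[Cq R]_7, 'M[Cq R]_7))
    (m : nat) (i j r s t : 'I_m) :
  let q := indet R in
  is_gamma q gamma ->
  (i < j)%N -> (j < r)%N -> (r < s)%N -> (s < t)%N ->
  eqA q m
    (q *: bmul q (Psi q gamma j s t) (Phi q i r))
    (q^-1 *: bmul q (Phi q i r) (Psi q gamma j s t)
     - (q - q^-1) *: bmul q (Phi q i j) (Psi q gamma r s t)
     - (q - q^-1) *:
         (- ((q ^+ 2 + q ^- 2) *: bmul q (Phi q j r) (Psi q gamma i s t))
          + Theta q gamma i j r s t)).
Proof.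
move=> q gammaP ij jr rs st.
rewrite /eqA (mul_Psi_Phi (@indet_transc R) gammaP ij jr rs st) subrr.
exact: Sq_ker0.
Qed.
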